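(* Let $\widehat G$ be a size-biased binary critical Galton-Watson tree and fix $n\ge1$. Let $\widehat G_n=\mathcal{P}_n(\widehat G)$ (all the random objects used by $\mathcal{P}_n$ being taken conditionally on $\widehat G$). Then for all $k\ge1$, $$\Pr(|L(\widehat G_n)|=k)=k\,c^n_k,$$ where $(c^n_k)_{k\ge1}$ is the unique solution to $(E_n)$.
   Context: For a $[0,\infty)$-valued sequence $u$ and $i\ge 0$, $m_i(u)=\sum_{k\ge1}k^iu_k$. For $n\in\mathbb{N}=\{1,2,\dots\}$, a sequence $c^n=(c^n_k)_{k\ge1}$ of nonnegative reals solves $(E_n)$ if $m_1(c^n)=1$ and, for all $k\ge2$, $\left(2+\frac{k-1}{n}\right)c^n_k=\frac{1}{m_0(c^n)}\sum_{i=1}^{k-1}c^n_ic^n_{k-i}$; it is known that there is exactly one solution. Trees. $T$ is a rooted discrete binary tree (each vertex has $0$ or $2$ children) with root $\emptyset$; one adds an extra vertex $\star$ and an edge joining $\star$ to $\emptyset$. $L(T)$ is the set of leaves; $\star$ is not a leaf, but $\emptyset$ is a leaf iff the vertex set is $\{\star,\emptyset\}$. $N(T)$ is the set of internal nodes: all vertices other than $\star$ and the leaves. Size-biased tree. Let $(G(i))_{i\ge1}$ be i.i.d. binary critical Galton-Watson trees (offspring distribution $(\delta_0+\delta_2)/2$). The size-biased binary critical Galton-Watson tree $\widehat G$ is the binary tree with one infinite branch (the backbone) with successive vertices $\star,\star1,\star2,\star3,\dots$ (the root being $\emptyset=\star1$), where for each $i\ge1$ the tree $G(i)$ is planted on $\star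 i$, i.e. the two children of $\star i$ are $\star(i+1)$ and the root of $G(i)$. Pruning procedure $\mathcal{P}_n$ for a tree $T$ with at most one infinite branch. Step 1: endow each edge $e$ with a length $\kappa_e$, where the $\kappa_e$ are i.i.d. exponential random variables with parameter $2$ (mean $1/2$). Step 2: conditionally on the lengths, for each $x\in N(T)$ let $\pi^n_x$ be a Poisson point process with rate $1/n$ (w.r.t. length) on the branch joining $x$ to $\star$, these processes being mutually independent. All marks are initially active. Step 3: explore the tree from the top down to $\star$ (points in order of decreasing distance to $\star$); each time an active mark is encountered, remove the whole subtree above the mark, replace it by a leaf, and deactivate all the marks of the processes $\pi^n_x$ corresponding to nodes $x$ in the removed subtree. Step 4: the resulting tree, containing $\star$, is $\mathcal{P}_n(T)$. When $T$ has an infinite branch, the procedure is made sense of as follows: let $e=(x_1,x_2)$ ($x_2$ child of $x_1$) be the first edge on the infinite branch, starting from $\star$, such that $\pi^n_{x_2}$ has a mark in $e$ (such an edge a.s. exists). Then $e$ is necessarily cut, either by $\pi^n_{x_2}$ or by a process corresponding to a node above $x_2$, and all processes corresponding to $x_2$ and to nodes above $x_2$ have no effect below that cut; so everything happens as if $x_2$ were a leaf of $T$ (everything above $x_2$ and all marks sent by $x_2$ and nodes above it being ignored), and $\mathcal{P}_n(T)$ is obtained (as a combinatorial tree) by applying the procedure to the resulting finite tree. *)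

(* Defs.v *)
(* MathComp / MathComp-Analysis *)
From HB Require Import structures.
From mathcomp Require Import all_boot all_order all_algebra finmap.
From mathcomp Require Import all_classical all_reals all_analysis.
Import Order.TTheory GRing.Theory Num.Theory.
Import numFieldNormedType.Exports.

Set Implicit Arguments.
Unset Strict Implicit.
Unset Printing Implicit Defensive.

Local Open Scope classical_set_scope.
Local Open Scope ring_scope.

(** * The equation (E_n) *)

(* Sequences are indexed by k >= 1; the value at 0 is never used. *)
Definition moment (R : realType) (i : nat) (u : nat -> R) : \bar R :=
  (\sum_(1 <= k <oo) (k%:R ^+ i * u k)%:E)%E.

(* [fine] is harmless: for u >= 0, moment 0 u <= moment 1 u = 1. *)
Definition solves_E (R : realType) (n : nat) (c : nat -> R) : Prop :=
  [/\ forall k : nat, (1 <= k)%N -> 0 <= c k,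
      moment 1 c = 1%E
    & forall k : nat, (2 <= k)%N ->
        (2 + (k%:R - 1) / n%:R) * c k
        = (fine (moment 0 c))^-1 * \sum_(1 <= i < k) c i * c (k - i)%N].

(** * Binary trees *)

(* A vertex other than the extra vertex star is the word of left/right turns
   leading to it from the root [::]. A tree is its set of vertices, star being
   left implicit. The edge e_v is the one just below v: it joins v to its
   parent, the parent of the root being star. Hence the edges on the branch
   from v to star are the e_u, for u a prefix of v. *)
Definition word := seq bool.

Definition strict_prefix (u v : word) : bool := prefix u v && (u != v).

Definition on_infinite_branch (T : set word) (v : word) : Prop :=
  exists b : nat -> bool, (forall m, T (mkseq b m)) /\ v = mkseq b (size v).

Definition is_leaf (F : {fset word}) (v : word) : bool :=
  [&& v \in F, rcons v false \notin F & rcons v true \notin F].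

Definition leaves (F : {fset word}) : {fset word} :=
  [fset v in F | is_leaf F v]%fset.

Definition is_internal (F : {fset word}) (v : word) : bool :=
  (v \in F) && ~~ is_leaf F v.

(* The Galton-Watson tree built from offspring numbers z, each 0 or 2. *)
Definition galton_watson (z : word -> nat) : set word :=
  [set u | forall v, strict_prefix v u -> z v = 2%N].

(* The backbone vertex star(i+1) is 0^i; its two children are star(i+2) = 0^i 0
   and the root 0^i 1 of G(i+1), the Galton-Watson tree with offspring
   numbers z i. *)
Definition size_biased (z : nat -> word -> nat) : set word :=
  [set v | exists i : nat, v = nseq i false \/
     exists2 u, galton_watson (z i) u & v = nseq i false ++ true :: u].

(** * The pruning procedure *)

Section Pruning.
Variables (R : realType) (kappa : word -> R) (ppp : word -> set R).
(* kappa v is the length of e_v. A point s of ppp x, a subset of [0, +oo[, is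
   a mark of pi_x located on the branch joining x to star at distance s from
   star; points beyond the length of that branch are not used. *)

Definition edge_bottom (v : word) : R := \sum_(i < size v) kappa (take i v).
Definition edge_top (v : word) : R := edge_bottom v + kappa v.

(* The vertex v such that the point at distance s from star on the branch from
   x to star lies on e_v. *)
Definition edge_at (x : word) (s : R) : word :=
  take (find (fun i => s < edge_top (take i x)) (iota 0 (size x).+1)) x.

Definition mark := (word * R)%type.

Definition marks (F : {fset word}) : set mark :=
  [set m | [/\ is_internal F m.1, ppp m.1 m.2 & 0 <= m.2 < edge_top m.1]].

Definition top_down (A : set mark) : seq mark :=
  sort (fun m m' => m'.2 <= m.2) (enum_fset (fset_set A)).

(* Cutting e_v: the leaf replacing the removed subtree, which contains v, is
   again called v. *)
Definition cut (F : {fset word}) (v : word) : {fset word} :=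
  [fset u in F | ~~ strict_prefix v u]%fset.

(* [removed x]: x was in a subtree already removed, so that the marks of pi_x
   have been deactivated. *)
Fixpoint explore (F : {fset word}) (removed : pred word) (ms : seq mark)
    : {fset word} :=
  match ms with
  | [::] => F
  | m :: ms' =>
      if removed m.1 then explore F removed ms'
      else let v := edge_at m.1 m.2 in
           explore (cut F v) (fun x => removed x || prefix v x) ms'
  end.

Definition prune_finite (F : {fset word}) : {fset word} :=
  explore F pred0 (top_down (marks F)).

Definition self_marked (v : word) : Prop :=
  exists2 s, ppp v s & edge_bottom v <= s < edge_top v.

Definition first_self_marked (T : set word) (v : word) : Prop :=
  [/\ on_infinite_branch T v, self_marked v
    & forall u, strict_prefix u v -> ~ self_marked u].

Definition truncate (T : set word) : set word :=
  [set u | T u /\ ~ exists2 v, first_self_marked T v & strict_prefix v u].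

(* [truncate T] is T itself when T is finite. When it is infinite (which has
   probability 0 for the size-biased tree), [fset_set] returns the empty set. *)
Definition prune (T : set word) : {fset word} :=
  prune_finite (fset_set (truncate T)).

End Pruning.

(** * The random objects *)

Section Randomness.
Variables (R : realType) (d : measure_display) (Omega : measurableType d).
Variable P : probability Omega R.

Definition mutually_independent (J : choiceType) (C : J -> set (set Omega)) : Prop :=
  forall (s : {fset J}) (A : J -> set Omega),
    (forall j, j \in s -> C j (A j)) ->
    P (\bigcap_(j in [set` s]) A j) = (\prod_(j <- s) P (A j))%E.

Definition sigma_of (d' : measure_display) (T' : measurableType d')
    (X : Omega -> T') : set (set Omega) :=
  [set X @^-1` B | B in measurable].

Definition count_is (N : Omega -> set R) (A : set R) (j : nat) : set Omega :=
  [set w | (N w `&` A #= `I_j)%card].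

Definition sigma_of_points (N : Omega -> set R) : set (set Omega) :=
  <<s [set E | exists (A : set R) (j : nat), measurable A /\ E = count_is N A j] >>.

(* Unlike the library's [poisson_pmf], which is constantly 1 at rate 0, this is
   the mass function of the Dirac mass at 0 when m = 0. *)
Definition poisson_weight (m : R) (j : nat) : R := m ^+ j / j`!%:R * expR (- m).

(* Poisson point process with rate lambda on [0, +oo[, as a random locally
   finite set. *)
Record poisson_point_process (lambda : R) (N : Omega -> set R) : Prop := {
  ppp_support : forall w, N w `<=` `[0, +oo[ ;
  ppp_locally_finite : forall w (a : R), finite_set (N w `&` `[0, a]) ;
  ppp_measurable : forall (A : set R) (j : nat), measurable A -> measurable (count_is N A j) ;
  ppp_law : forall (A : set R) (j : nat), measurable A -> A `<=` `[0, +oo[ ->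
    (lebesgue_measure A < +oo)%E ->
    P (count_is N A j) = (poisson_weight (lambda * fine (lebesgue_measure A)) j)%:E ;
  ppp_indep : forall (r : nat) (A : 'I_r -> set R) (j : 'I_r -> nat),
    (forall i, measurable (A i)) -> trivIset setT A ->
    P (\bigcap_i count_is N (A i) (j i)) = (\prod_(i < r) P (count_is N (A i) (j i)))%E
}.

(* offspring i u is the number of children of the vertex u of G(i+1). The
   families are indexed by all words, but [size_biased] and [prune] only look at
   those that are addresses of vertices of the tree. As the half-line processes
   ppp x are independent of the lengths and of the tree, their restrictions to
   the branches are, conditionally on these, independent Poisson point
   processes. *)
Record pruning_model (n : nat) (offspring : nat -> word -> {RV P >-> nat})
    (kappa : word -> {RV P >-> R}) (ppp : word -> Omega -> set R) : Prop := {
  offspring_law : forall i u, P (offspring i u @^-1` [set 0%N]) = (2^-1)%:E /\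
                              P (offspring i u @^-1` [set 2%N]) = (2^-1)%:E ;
  kappa_gt0 : forall v w, 0 < kappa v w ;
  kappa_law : forall v B, measurable B ->
    distribution P (kappa v) B = exponential_prob 2 B ;
  ppp_rate : forall x, poisson_point_process (n%:R^-1) (ppp x) ;
  model_indep : mutually_independent
    (fun j : (nat * word) + (word + word) =>
       match j with
       | inl iu => sigma_of (offspring iu.1 iu.2)
       | inr (inl v) => sigma_of (kappa v)
       | inr (inr x) => sigma_of_points (ppp x)
       end)
}.

End Randomness.

(* Main.v *)
(* Whether an edge e_v is cut only depends on which processes pi_x, x above v,
   have a mark on it, and this whole array of marks can be integrated out: given
   the lengths the marks on e_v avoid k given processes with probability
   exp(- k kappa_v / n), hence 2 / (2 + k/n) after averaging, independently for
   distinct edges and of the offspring numbers. Read from the leaves to the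
   root, the pruning is then a branching recursion: a pruned subtree with k
   internal nodes survives the edge below it with probability 2 / (2 + k/n) and
   otherwise becomes a leaf. The law p of the number of internal nodes above a
   vertex off the backbone thus satisfies
     (2 + k/n) p_k = sum_(i + j = k - 1) p_i p_j   (k >= 1),  sum_k p_k = 1,
   which forces p_k = c_(k+1) / m_0(c). On the backbone, e_v carrying a mark of
   its own process plays the part of v being a leaf, and the law q satisfies
     (2 + k/n) q_k = 2 sum_(i + j = k - 1) q_i p_j  (k >= 1),  sum_k q_k = 1,
   whose only solution is q_k = (k + 1) c_(k+1). *)
Require Import Defs.
From mathcomp Require Import all_boot all_order all_algebra finmap.
From mathcomp Require Import all_classical all_reals all_analysis.
From mathcomp Require Import ring lra zify.
Import Order.TTheory GRing.Theory Num.Theory.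
Import numFieldNormedType.Exports.

Set Implicit Arguments.
Unset Strict Implicit.
Unset Printing Implicit Defensive.

Local Open Scope classical_set_scope.
Local Open Scope ring_scope.

(** The model grants independence only for events attached to separate lengths, processes and
    offspring numbers, whereas the place of e_v on a branch depends on all the lengths below it.
    Conditioning on the lengths is therefore replaced by rounding them down to a grid: on one cell
    of the grid every edge is a fixed interval and the probability is a finite product; the sum over
    the cells factors edge by edge into discretized Laplace transforms, and the mesh then tends to
    0. The number of processes to be avoided on e_v is itself random. It is handled by summing over
    all pairs of lists of surviving nodes that the two children can deliver: given the pair, the
    processes are fixed and only their number matters. That the laws have total mass 1 is an
    extinction argument. With t the probability that the recursion from the leaves ends, t = (1 +
    t^2)/2 off the backbone has the double root 1 by criticality; on the backbone t = 1 - r + r t,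
    where r = 2/(2 + 1/n) < 1 because a backbone edge may carry a mark of its own process. The
    weight k + 1 in q comes from symmetrizing the convolution in i and j. *)

Lemma prefix_takeE (u x : word) : prefix u x -> u = take (size u) x.
Proof. by rewrite prefixE => /eqP. Qed.

Lemma prefix_comparable (u v x : word) :
  prefix u x -> prefix v x -> (size u <= size v)%N -> prefix u v.
Proof.
move=> /prefix_takeE hu /prefix_takeE hv h.
by rewrite prefixE {1}hv take_takel // -hu.
Qed.

Lemma strict_prefixE (u v : word) :
  strict_prefix u v = prefix u v && (size u < size v)%N.
Proof.
rewrite /strict_prefix; case: (boolP (prefix u v)) => //= uv.
have := size_prefix uv; rewrite leq_eqVlt => /orP[/eqP e|lt].
  by rewrite e ltnn; apply/negbTE; rewrite negbK; apply/eqP;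
     rewrite [LHS](prefix_takeE uv) e take_size.
by rewrite lt; apply/negP => /eqP e; rewrite e ltnn in lt.
Qed.

Lemma strict_prefix_rcons (u v : word) b :
  strict_prefix u (rcons v b) = prefix u v.
Proof.
rewrite strict_prefixE size_rcons ltnS.
apply/andP/idP => [[uv le]|uv].
  by apply: (prefix_comparable uv) => //; rewrite prefix_rcons.
by split; [apply: (prefix_trans uv); rewrite prefix_rcons | exact: size_prefix].
Qed.

Lemma prefix_strictW (u v : word) : prefix u v = (u == v) || strict_prefix u v.
Proof.
rewrite /strict_prefix; case: eqVneq => [->|]; first by rewrite prefix_refl.
by rewrite andbT.
Qed.

(** * Positions of the edges along a branch *)

Section Geometry.
Variables (R : realType) (kappa : word -> R).
(** Lengths may vanish here: the rounded lengths used later do. *)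
Hypothesis kappa_ge0 : forall v, 0 <= kappa v.

Lemma edge_bottomE u x : prefix u x ->
  edge_bottom kappa u = \sum_(0 <= i < size u) kappa (take i x).
Proof.
move=> /prefix_takeE ux; rewrite /edge_bottom big_mkord; apply: eq_bigr => i _.
have -> : take i u = take i (take (size u) x) by rewrite -ux.
by rewrite take_takel // ltnW.
Qed.

Lemma edge_topE u x : prefix u x ->
  edge_top kappa u = \sum_(0 <= i < (size u).+1) kappa (take i x).
Proof.
move=> ux; rewrite /edge_top (edge_bottomE ux) big_nat_recr //=.
by rewrite -(prefix_takeE ux).
Qed.

Lemma sum_take_le (x : word) m n : (m <= n)%N ->
  \sum_(0 <= i < m) kappa (take i x) <= \sum_(0 <= i < n) kappa (take i x).
Proof.
move=> mn; rewrite (big_cat_nat (n := m) _ mn) //= lerDl.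
by apply: sumr_ge0 => i _.
Qed.

Lemma edge_bottom_ge0 v : 0 <= edge_bottom kappa v.
Proof. by apply: sumr_ge0 => i _. Qed.

Lemma edge_top_le_bottom u v : strict_prefix u v ->
  edge_top kappa u <= edge_bottom kappa v.
Proof.
rewrite strict_prefixE => /andP[uv lt].
by rewrite (edge_topE uv) (edge_bottomE (prefix_refl v)) sum_take_le.
Qed.

Lemma edge_top_mono u v : prefix u v -> edge_top kappa u <= edge_top kappa v.
Proof.
by move=> uv; rewrite (edge_topE uv) (edge_topE (prefix_refl v)) sum_take_le //
  ltnS size_prefix.
Qed.

Lemma edge_at_spec x s : 0 <= s < edge_top kappa x ->
  prefix (edge_at kappa x s) x /\
  edge_bottom kappa (edge_at kappa x s) <= s < edge_top kappa (edge_at kappa x s).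
Proof.
move=> /andP[s0 sx]; split; first exact: prefix_take.
rewrite /edge_at; set p := fun i => _; set i0 := find _ _.
have hasp : has p (iota 0 (size x).+1).
  apply/hasP; exists (size x); first by rewrite mem_iota; lia.
  by rewrite /p take_size.
have i0lt : (i0 < (size x).+1)%N by rewrite -[ltnRHS](size_iota 0) -has_find.
have := nth_find 0%N hasp; rewrite -/i0 nth_iota // add0n /p => ->.
rewrite andbT (edge_bottomE (prefix_take x i0)) size_takel //.
(* Index 0 is the root edge, which starts at distance 0; otherwise minimality of [find] puts the top
   of the previous edge at or below s. *)
have [->|i0p] := posnP i0; first by rewrite big_nil.
have lt : (i0.-1 < i0)%N by lia.
have := before_find 0%N lt; rewrite nth_iota; last by lia.
rewrite add0n /p => /negbT; rewrite -leNgt (edge_topE (prefix_take x _)).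
have le : (i0.-1 <= size x)%N by rewrite -ltnS prednK // ltnW.
by rewrite size_takel // prednK.
Qed.

Lemma edge_at_uniq u x s : prefix u x ->
  edge_bottom kappa u <= s < edge_top kappa u -> edge_at kappa x s = u.
Proof.
move=> ux /andP[us su].
have s0 : 0 <= s by exact: le_trans (edge_bottom_ge0 u) us.
have [|vx /andP[vs sv]] := @edge_at_spec x s.
  by rewrite s0 (lt_le_trans su) // edge_top_mono.
set v := edge_at _ _ _ in vx vs sv *.
case: (ltngtP (size u) (size v)) => h.
- have uv : strict_prefix u v.
    by rewrite strict_prefixE h (prefix_comparable ux vx) // ltnW.
  by have := le_trans (edge_top_le_bottom uv) vs; rewrite leNgt su.
- have vu : strict_prefix v u.
    by rewrite strict_prefixE h (prefix_comparable vx ux) // ltnW.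
  by have := le_trans (edge_top_le_bottom vu) us; rewrite leNgt sv.
- by rewrite (prefix_takeE ux) h -(prefix_takeE vx).
Qed.

End Geometry.

(** [hit x x] is [self_marked x]. The notion is meaningful only when v is a prefix of x; otherwise s
    is a distance along another branch. *)
Definition hit (R : realType) (kappa : word -> R) (ppp : word -> set R) (x v : word) :=
  exists2 s, ppp x s & edge_bottom kappa v <= s < edge_top kappa v.

(** * The top-down exploration *)

Section Explore.
Variables (R : realType) (kappa : word -> R) (ppp : word -> set R).
Hypothesis kappa_ge0 : forall v, 0 <= kappa v.
Hypothesis ppp_fin : forall x a, finite_set (ppp x `&` `[0, a]).
Variables (F : {fset word}) (cutE : pred word).
(** A recursion from the leaves down: the right-hand side consults only edges strictly above e_u.
    The order in which the marks are met does not appear in it. *)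
Hypothesis cutE_P : forall u, cutE u <-> exists x, [/\ is_internal F x, prefix u x,
  (forall u', strict_prefix u u' -> prefix u' x -> ~~ cutE u') & hit kappa ppp x u].

(** [top_down] goes through [fset_set], which would return the empty set on an infinite set of
    marks. *)
Lemma finite_marks : finite_set (marks kappa ppp F).
Proof.
have -> : marks kappa ppp F = \bigcup_(x in [set` F])
    [set (x, s) | s in (ppp x `&` `[0, edge_top kappa x]) `&`
      [set s | is_internal F x /\ s < edge_top kappa x]].
  apply/seteqP; split=> [[x s] /= [Fx xs /andP[s0 sx]]|[x s] /= [y yF] [t]].
    exists x; first by move: Fx => /andP[].
    exists s => //; split=> //; split=> //=.
    by rewrite in_itv /= s0 ltW.
  move=> [[yt]] /=; rewrite in_itv /= => /andP[t0 _] [yi ty] [<- <-].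
  by split=> //=; rewrite t0.
apply: bigcup_finite => // x _; apply: finite_image.
exact/finite_setIl.
Qed.

Lemma mem_top_down m :
  (m \in top_down (marks kappa ppp F)) = (m \in marks kappa ppp F).
Proof.
rewrite /top_down mem_sort -[LHS]/(m \in fset_set (marks kappa ppp F)).
by rewrite in_fset_set //; exact: finite_marks.
Qed.

(* C lists the edges cut so far. No mark still to come lies above a cut edge,
   and a mark (x, s) already seen either cut its edge or was deactivated by a
   cut between that edge and x. *)
Lemma explore_spec (ms : seq (mark R)) (G : {fset word}) (removed : pred word) (C : seq word) :
  pairwise (fun m m' : mark R => m'.2 <= m.2) ms ->
  (forall m, m \in ms -> marks kappa ppp F m) ->
  (forall x, removed x = has (fun w : word => prefix w x) C) ->
  (forall u, (u \in G) = (u \in F) && ~~ has (strict_prefix^~ u) C) ->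
  (forall u, u \in C -> cutE u) ->
  (forall u m, u \in C -> m \in ms -> m.2 < edge_top kappa u) ->
  (forall m, marks kappa ppp F m -> m \notin ms ->
     exists u, [/\ u \in C, prefix (edge_at kappa m.1 m.2) u & prefix u m.1]) ->
  forall u, (u \in explore kappa G removed ms) <->
    u \in F /\ forall v, strict_prefix v u -> ~~ cutE v.
Proof.
elim: ms G removed C => [|[x s] ms IH] G removed C /=.
  move=> _ _ _ GE Csound _ Ccomp u.
  have CE v : cutE v <-> v \in C.
    split; last exact: Csound.
    (* The mark of y on e_v has been met, so some edge of [C] lies between e_v and y; by the choice
       of y it can only be e_v. *)
    move=> /cutE_P[y [yint vy alive [t yt tv]]].
    have [|//|w [wC]] := Ccomp (y, t).
      split=> //=; have /andP[vt tv'] := tv.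
      rewrite (le_trans (edge_bottom_ge0 kappa_ge0 v) vt) /=.
      by rewrite (lt_le_trans tv') // edge_top_mono.
    rewrite /= (edge_at_uniq kappa_ge0 vy tv) => vw wy.
    move: vw; rewrite prefix_strictW => /orP[/eqP -> //|vw].
    by have /negP := alive _ vw wy; rewrite Csound.
  rewrite GE; split => [/andP[uF /hasPn h]|[uF h]].
    split=> // v vu; apply/negP => /CE vC.
    by have := h _ vC; rewrite vu.
  by rewrite uF /=; apply/hasPn => v /CE vC; apply/negP => /h; rewrite vC.
move=> /andP[/allP smax pms] msF remE GE Csound Clow Ccomp.
have [xint xs /andP[s0 sx]] := msF (x, s) (mem_head _ _).
rewrite /= in xint xs s0 sx.
have [vx vsI] : prefix (edge_at kappa x s) x /\ edge_bottom kappa (edge_at kappa x s)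
    <= s < edge_top kappa (edge_at kappa x s).
  by apply: edge_at_spec; rewrite ?s0.
set v := edge_at _ _ _ in vx vsI *.
have /andP[vs sv] := vsI.
case: ifPn => [|]; rewrite remE.
  (* Deactivated mark: the cut edge e_w that removed x is not below e_v, for s would then be at or
     above the top of e_w, against [Clow]. *)
  move=> /hasP[w wC wx]; apply: (IH _ _ C) => //.
  - by move=> m mms; apply: msF; rewrite inE mms orbT.
  - by move=> u m uC mms; apply: Clow => //; rewrite inE mms orbT.
  - move=> m mF mms; have [e|ne] := eqVneq m (x, s); last first.
      by apply: Ccomp => //; rewrite inE negb_or ne.
    exists w; rewrite e /=; split=> //; rewrite -/v.
    apply: (prefix_comparable vx wx); rewrite leqNgt; apply/negP => lt.
    have wv : strict_prefix w v.
      by rewrite strict_prefixE lt (prefix_comparable wx vx) // ltnW.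
    have := le_trans (edge_top_le_bottom kappa_ge0 wv) vs.
    by rewrite leNgt (Clow w (x, s)) ?mem_head.
move=> /hasPn alivex.
apply: (IH _ _ (v :: C)) => //.
- by move=> m mms; apply: msF; rewrite inE mms orbT.
- by move=> y /=; rewrite remE orbC.
- move=> u; rewrite /cut !inE /= GE /=; case: (u \in F) => //=.
  by rewrite negb_or andbC.
- move=> u0; rewrite inE => /orP[/eqP ->|]; last exact: Csound.
  apply/cutE_P; exists x; split=> //; last by exists s.
  (* Active mark: a cut edge e_u strictly between e_v and x would come from a mark higher than s,
     hence already met. The edge it left in [C] is either e_u, and x was removed, or lies above e_u,
     and y was deactivated. *)
  move=> u vu ux; apply/negP => /[dup] cu /cutE_P[y [yint uy alive [t yt tu]]].
  have /andP[ut tu'] := tu.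
  have st : s < t.
    by rewrite (lt_le_trans sv) // (le_trans _ ut) // edge_top_le_bottom.
  have [||w [wC]] := Ccomp (y, t).
  + split=> //=; rewrite (ltW (le_lt_trans s0 st)) /=.
    by rewrite (lt_le_trans tu') // edge_top_mono.
  + rewrite inE negb_or xpair_eqE negb_and (gt_eqF st) orbT /=.
    by apply/negP => /smax /=; rewrite leNgt st.
  rewrite /= (edge_at_uniq kappa_ge0 uy tu) => uw wy.
  move: uw; rewrite prefix_strictW => /orP[/eqP uw|uw].
    by have := alivex _ wC; rewrite -uw ux.
  by have /negP := alive _ uw wy; rewrite Csound.
- move=> u m; rewrite inE => /orP[/eqP -> mms|uC mms].
    exact: le_lt_trans (smax _ mms) sv.
  by apply: Clow => //; rewrite inE mms orbT.
- move=> m mF mms; have [->|ne] := eqVneq m (x, s).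
    by exists v; rewrite mem_head prefix_refl.
  have [|w [wC mw wm]] := Ccomp m mF; first by rewrite inE negb_or ne.
  by exists w; rewrite inE wC orbT.
Qed.

Lemma prune_finiteP u : (u \in prune_finite kappa ppp F) <->
  u \in F /\ forall v, strict_prefix v u -> ~~ cutE v.
Proof.
apply: (explore_spec (C := [::])) => //.
- rewrite -sorted_pairwise; last by move=> a b c /= h1 h2; exact: le_trans h2 h1.
  by apply: sort_sorted => a b /=; exact: le_total.
- by move=> m; rewrite mem_top_down => /set_mem.
- by move=> u'; rewrite andbT.
- by move=> m mF; rewrite mem_top_down => /negP[]; exact: mem_set.
Qed.

End Explore.

(** * Pruning computed from the leaves to the root *)

Section Act.
Variables (split : word -> bool) (hitb : word -> word -> bool).

(** Cutting e_v turns v into a leaf, so no internal node is left. *)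
Definition cross (v : word) (s : seq word) : seq word :=
  if has (fun x => hitb x v) s then [::] else s.

(* [act h v] lists the internal nodes that survive the pruning of the subtree
   above v, the edge e_v included; it is [None] when this subtree is higher
   than h. *)
Fixpoint act (h : nat) (v : word) : option (seq word) :=
  if split v then
    if h is h'.+1 then
      match act h' (rcons v false), act h' (rcons v true) with
      | Some a, Some b => Some (cross v (v :: a ++ b))
      | _, _ => None
      end
    else None
  else Some [::].

Definition split_tree : set word := [set u | forall v, strict_prefix v u -> split v].

Lemma actS h v s : act h v = Some s -> act h.+1 v = Some s.
Proof.
elim: h v s => [|h IH] v s /=; first by case: (split v).
case: (split v) => //.
case E0: (act h _) => [a|//]; case E1: (act h (rcons v true)) => [b|//] <-.
by rewrite -/(act h.+1 _) (IH _ _ E0) -/(act h.+1 _) (IH _ _ E1).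
Qed.

Lemma act_mono h h' v s : (h <= h')%N -> act h v = Some s -> act h' v = Some s.
Proof.
by move=> /subnK <-; elim: (h' - h)%N => // k IH /IH /actS.
Qed.

Lemma act_inj h h' v s s' : act h v = Some s -> act h' v = Some s' -> s = s'.
Proof.
move=> e e'; case: (leqP h h') => [le|/ltnW le].
  by move: (act_mono le e); rewrite e' => -[].
by move: (act_mono le e'); rewrite e => -[].
Qed.

Lemma prefix_rcons_cases (v x : word) : prefix v x ->
  [\/ x = v, prefix (rcons v false) x | prefix (rcons v true) x].
Proof.
move=> /prefixP[[|b s] ->]; first by rewrite cats0; constructor 1.
by rewrite -cat_rcons; case: b; [constructor 3|constructor 2]; rewrite prefix_prefix.
Qed.

Lemma prefix_rcons_disj (v x : word) :
  prefix (rcons v false) x -> prefix (rcons v true) x -> False.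
Proof.
move=> /prefix_takeE; rewrite size_rcons => h /prefix_takeE; rewrite size_rcons -h.
by move=> /(congr1 (last true)); rewrite !last_rcons.
Qed.

Lemma prefix_rconsW (v x : word) b : prefix (rcons v b) x -> strict_prefix v x.
Proof.
move=> h; rewrite strict_prefixE (prefix_trans (prefix_rcons _ _) h) /=.
by have := size_prefix h; rewrite size_rcons.
Qed.

(** Distinctness matters because the probability that the listed processes all miss an edge depends
    on how many they are. *)
Lemma children_uniq (v : word) (a b : seq word) :
  uniq a && all (prefix (rcons v false)) a -> uniq b && all (prefix (rcons v true)) b ->
  uniq (v :: a ++ b) && all (prefix v) (v :: a ++ b).
Proof.
move=> /andP[ua /allP pa] /andP[ub /allP pb]; apply/andP; split.
  rewrite cons_uniq cat_uniq ua ub mem_cat negb_or andbT /=.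
  have vN c (s : seq word) : {in s, forall x, prefix (rcons v c) x} -> v \notin s.
    by move=> hs; apply/negP => /hs /prefix_rconsW; rewrite strict_prefixE ltnn andbF.
  rewrite (vN _ _ pa) (vN _ _ pb) /=; apply/hasPn => x /pb h1.
  by apply/negP => /pa h0; exact: prefix_rcons_disj h0 h1.
apply/allP => x; rewrite inE mem_cat => /or3P[/eqP ->|/pa|/pb].
- exact: prefix_refl.
- by move=> /prefix_rconsW /andP[].
- by move=> /prefix_rconsW /andP[].
Qed.

Lemma act_uniq h v s : act h v = Some s -> uniq s && all (prefix v) s.
Proof.
elim: h v s => [|h IH] v s /=; first by case: (split v) => // -[<-].
case: (split v) => [|[<-]//].
case E0: (act h _) => [a|//]; case E1: (act h (rcons v true)) => [b|//] [<-].
by rewrite /cross; case: ifP => // _; apply: children_uniq; exact: IH.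
Qed.

(** Failure at height h amounts to h + 1 successive splits along some branch; together with the
    converse below, finiteness of the tree becomes success of [act] at some height. *)
Lemma act_none h v : act h v = None ->
  exists2 u : word, size u = h & forall i, (i <= h)%N -> split (v ++ take i u).
Proof.
elim: h v => [|h IH] v /=; case E: (split v) => //.
  by exists [::] => // i _; rewrite cats0.
have hb b : act h (rcons v b) = None ->
    exists2 u : word, size u = h.+1 & forall i, (i <= h.+1)%N -> split (v ++ take i u).
  move=> /IH[u su hu]; exists (b :: u); first by rewrite /= su.
  by move=> [|i] ih /=; [rewrite cats0|rewrite -cat_rcons hu].
case E0: (act h _) => [a|]; last by move=> _; exact: (hb false).
by case E1: (act h (rcons v true)) => [b|] // _; exact: (hb true).
Qed.

Lemma act_none_of h v (u : word) : (h <= size u)%N ->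
  (forall i, (i <= h)%N -> split (v ++ take i u)) -> act h v = None.
Proof.
elim: h v u => [|h IH] v u hu sp /=; have := sp 0%N; rewrite take0 cats0 => -> //.
case: u hu sp => // b u hu sp.
have e : act h (rcons v b) = None.
  by apply: (IH _ u) => // i ih; rewrite cat_rcons; exact: (sp i.+1).
by case: b e hu sp => -> *; case: (act h _).
Qed.

Lemma split_tree_prefix u v : prefix u v -> split_tree v -> split_tree u.
Proof.
move=> uv Tv w; rewrite strict_prefixE => /andP[wu lt]; apply: Tv.
by rewrite strict_prefixE (prefix_trans wu uv) (leq_trans lt) // size_prefix.
Qed.

Lemma split_tree_rcons v b : split_tree (rcons v b) <-> split_tree v /\ split v.
Proof.
split=> [T|[T sv] u].
  split; first by apply: split_tree_prefix T; exact: prefix_rcons.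
  by apply: T; rewrite strict_prefix_rcons prefix_refl.
by rewrite strict_prefix_rcons prefix_strictW => /orP[/eqP ->//|]; exact: T.
Qed.

Lemma finite_words_le h : finite_set [set u : word | (size u <= h)%N].
Proof.
elim: h => [|h IH].
  apply: (sub_finite_set _ (finite_set1 [::])) => u /=.
  by rewrite leqn0 size_eq0 => /eqP.
have : finite_set ([set [::]] `|` (cons true @` [set u | (size u <= h)%N])
    `|` (cons false @` [set u : word | (size u <= h)%N])).
  by rewrite !finite_setU; split; [split|]; [exact: finite_set1|exact: finite_image..].
apply: sub_finite_set => -[|b u] /= hu; first by left; left.
by case: b; [left; right|right]; exists u.
Qed.

Lemma split_tree_finite : finite_set split_tree <-> exists h, act h [::] <> None.
Proof.
split=> [fin|[h hN]].
  apply: contrapT => /forallNP N.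
  have /(_ _)/contrapT/act_none Nh h := N h.
  have inj : exists h, forall u, split_tree u -> (size u <= h)%N.
    exists (\max_(u <- fset_set split_tree) size u)%N => u Tu.
    by rewrite (big_fsetD1 u) ?leq_maxl //= in_fset_set // inE.
  have [h hh] := inj.
  have [u su hu] := Nh h.+1.
  have : split_tree u.
    move=> v; rewrite strict_prefixE => /andP[vu lt]; rewrite (prefix_takeE vu).
    by apply: hu; rewrite -su ltnW.
  by move=> /hh; rewrite su ltnn.
apply: (sub_finite_set _ (finite_words_le h)) => u Tu /=.
rewrite leqNgt; apply/negP => lt; apply: hN.
apply: (@act_none_of _ _ u); first exact: ltnW.
move=> i ih; apply: Tu; rewrite strict_prefixE prefix_take size_takel; last by lia.
exact: leq_ltn_trans lt.
Qed.

Section FiniteTree.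
Variable F : {fset word}.
Hypothesis FE : forall u, (u \in F) <-> split_tree u.

Lemma internalE x : is_internal F x = (x \in F) && split x.
Proof.
rewrite /is_internal /is_leaf; case: (boolP (x \in F)) => //= xF.
have h b : (rcons x b \in F) = split x.
  by apply/idP/idP => [/FE/split_tree_rcons[]//|sx]; apply/FE/split_tree_rcons;
     split=> //; exact/FE.
by rewrite !h; case: (split x).
Qed.

Lemma mem_prefix u x : x \in F -> prefix u x -> u \in F.
Proof. by move=> /FE Fx ux; apply/FE; exact: split_tree_prefix Fx. Qed.

(** The candidate for [cutE]. The lists of the two children, taken before e_v is crossed, are
    together with v the nodes whose marks on e_v are still active. The height is existential since
    any sufficient one gives the same lists. *)
Definition edge_cut (v : word) : bool :=
  (v \in F) && `[< exists h a b, [/\ split v, act h (rcons v false) = Some a,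
    act h (rcons v true) = Some b & has (fun x => hitb x v) (v :: a ++ b)] >].

Definition survives (v x : word) :=
  [/\ is_internal F x, prefix v x &
      forall u, prefix v u -> prefix u x -> ~~ edge_cut u].

Lemma survives_strict h v a b x : v \in F -> split v ->
  (forall x, x \in a <-> survives (rcons v false) x) ->
  (forall x, x \in b <-> survives (rcons v true) x) ->
  act h (rcons v false) = Some a -> act h (rcons v true) = Some b ->
  x \in v :: a ++ b <->
  [/\ is_internal F x, prefix v x &
    forall u, strict_prefix v u -> prefix u x -> ~~ edge_cut u].
Proof.
move=> vF sv ha hb Ea Eb.
have sub c : survives (rcons v c) x -> [/\ is_internal F x, prefix v x &
    forall u, strict_prefix v u -> prefix u x -> ~~ edge_cut u].
  move=> [xi vx H]; have vx' := prefix_rconsW vx; split=> //.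
    by case/andP: vx'.
  move=> u vu ux; apply: H => //; apply: (prefix_comparable vx ux).
  by move: vu; rewrite strict_prefixE size_rcons => /andP[].
have bus c : prefix (rcons v c) x -> is_internal F x ->
    (forall u, strict_prefix v u -> prefix u x -> ~~ edge_cut u) ->
    survives (rcons v c) x.
  move=> vx xi H; split=> // u /prefix_rconsW; exact: H.
rewrite inE mem_cat; split.
  move=> /or3P[/eqP ->|/ha/sub//|/hb/sub//].
  rewrite internalE vF sv prefix_refl; split=> // u.
  by rewrite strict_prefixE => /andP[_ lt] /size_prefix; rewrite leqNgt lt.
move=> [xi vx H]; apply/or3P; case: (prefix_rcons_cases vx) => [->|vx'|vx'].
- by constructor 1.
- by constructor 2; apply/ha; exact: bus.
- by constructor 3; apply/hb; exact: bus.
Qed.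

(** By induction on the height: at v, [cross] empties the list exactly when [edge_cut v] holds. *)
Lemma act_survives h v s : v \in F -> act h v = Some s ->
  forall x, x \in s <-> survives v x.
Proof.
have leaf v' x : ~~ split v' -> ~ survives v' x.
  move=> sv [+ vx _]; rewrite internalE => /andP[/FE Tx sx].
  move: vx; rewrite prefix_strictW => /orP[/eqP vx|/Tx]; last exact/negP.
  by rewrite -vx (negbTE sv) in sx.
elim: h v s => [|h IH] v s vF /=; case E: (split v) => //.
- by move=> [<-] x; split=> // /leaf; rewrite E; case.
- case E0: (act h _) => [a|//]; case E1: (act h (rcons v true)) => [b|//] [<-] x.
  have vbF c : rcons v c \in F by apply/FE/split_tree_rcons; split=> //; exact/FE.
  have := survives_strict x vF E (IH _ _ (vbF _) E0) (IH _ _ (vbF _) E1) E0 E1.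
  move=> H; rewrite /cross; case: ifPn => has_v.
    split=> // -[_ vx /(_ v (prefix_refl v) vx)]; rewrite /edge_cut vF /=.
    by move=> /asboolPn[]; exists h, a, b.
  rewrite H; split=> -[xi vx K]; split=> // u.
    rewrite prefix_strictW => /orP[/eqP <- _|]; last exact: K.
    rewrite negb_and vF /=; apply/asboolPn => -[h' [a' [b' [_ E0' E1' ]]]].
    by rewrite -(act_inj E0 E0') -(act_inj E1 E1'); exact/negP.
  by move=> /andP[vu _]; exact: K.
- by move=> [<-] x; split=> // /leaf; rewrite E; case.
Qed.

Lemma act_in_tree v : v \in F -> exists h, act h v <> None.
Proof.
move=> vF; apply: contrapT => /forallNP N.
have /split_tree_finite[h hN] : finite_set split_tree.
  by apply: (sub_finite_set _ (finite_fset F)) => u /FE.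
have /(_ h)/contrapT/act_none[u su hu] := N.
apply: hN; apply: (@act_none_of _ _ (v ++ u)); first by rewrite size_cat; lia.
move=> i ih; rewrite /= take_cat; case: ltnP => iv; last by apply: hu; lia.
apply: (proj1 (FE v) vF); rewrite strict_prefixE prefix_take size_takel //; exact: ltnW.
Qed.

(** The nodes in the lists behind [edge_cut u] are, by [survives_strict], the candidates x on the
    right. This is the recursion required of [cutE], so the exploration and the computation from the
    leaves agree. *)
Lemma edge_cutP u : edge_cut u <-> exists x, [/\ is_internal F x, prefix u x,
  (forall u', strict_prefix u u' -> prefix u' x -> ~~ edge_cut u') & hitb x u].
Proof.
split.
  move=> /[dup] cu /andP[uF /asboolP[h [a [b [su E0 E1 /hasP[x xab xu]]]]]].
  have ubF c : rcons u c \in F by apply/FE/split_tree_rcons; split=> //; exact/FE.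
  have [xi ux H] := (survives_strict x uF su (act_survives (ubF _) E0)
                      (act_survives (ubF _) E1) E0 E1).1 xab.
  by exists x.
move=> [x [xi ux H xu]].
have xF : x \in F by case/andP: xi.
have uF := mem_prefix xF ux.
have su : split u.
  move: ux; rewrite prefix_strictW => /orP[/eqP ->|]; last by move/FE: xF; apply.
  by move: xi; rewrite internalE => /andP[].
have ubF c : rcons u c \in F by apply/FE/split_tree_rcons; split=> //; exact/FE.
have [h0] := act_in_tree (ubF false); case E0: (act h0 _) => [a|//] _.
have [h1] := act_in_tree (ubF true); case E1: (act h1 _) => [b|//] _.
have E0' := act_mono (leq_maxl h0 h1) E0; have E1' := act_mono (leq_maxr h0 h1) E1.
rewrite /edge_cut uF; apply/asboolP; exists (maxn h0 h1), a, b; split=> //.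
apply/hasP; exists x => //.
by apply: (survives_strict x uF su (act_survives (ubF _) E0)
            (act_survives (ubF _) E1) E0' E1').2.
Qed.

(** Apart from the root, the vertices of G are the two children of each surviving node: 2 size s + 1
    vertices, of which the size s survivors are internal. *)
Lemma card_leaves_act (G : {fset word}) h s : act h [::] = Some s ->
  (forall u, u \in G <-> u \in F /\ forall v, strict_prefix v u -> ~~ edge_cut v) ->
  #|` leaves G| = (size s).+1.
Proof.
move=> Es GE.
have rF : [::] \in F by apply/FE => v; rewrite strict_prefixE ltn0 andbF.
have sE x : x \in s <-> is_internal F x /\ forall u, prefix u x -> ~~ edge_cut u.
  rewrite (act_survives rF Es); split=> [[xi _ H]|[xi H]]; split=> //.
  - by move=> u ux; apply: H => //; exact: prefix0s.
  - exact: prefix0s.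
  - by move=> u _; exact: H.
have Gr v b : (rcons v b \in G) = (v \in s).
  apply/idP/idP => [/GE[vbF H]|/sE[vi H]].
    apply/sE; split; last by move=> u uv; apply: H; rewrite strict_prefix_rcons.
    move: vbF => /FE/split_tree_rcons[/FE vF sv].
    by rewrite internalE vF.
  apply/GE; split; last by move=> u; rewrite strict_prefix_rcons; exact: H.
  move: vi; rewrite internalE => /andP[/FE vF sv].
  by apply/FE/split_tree_rcons.
have G0 : [::] \in G by apply/GE; split=> // v; rewrite strict_prefixE ltn0 andbF.
have /andP[us _] := act_uniq Es.
pose L : seq word := [::] :: (map (rcons^~ false) s ++ map (rcons^~ true) s).
have uL : uniq L.
  rewrite /L cons_uniq cat_uniq !map_inj_uniq ?us //; try exact: rcons_injl.
  have nil_notin c : [::] \notin map (rcons^~ c) s.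
    by apply/negP => /mapP[[|? ?] _].
  rewrite mem_cat negb_or !nil_notin /= andbT; apply/hasPn => x /mapP[y _ ->].
  by apply/negP => /mapP[z _ /(congr1 (last true))]; rewrite !last_rcons.
have LE : G =i L.
  move=> u; case/lastP: u => [|u b]; first by rewrite G0 mem_head.
  rewrite Gr inE mem_cat; have -> : (rcons u b == [::]) = false by case: u.
  have mp c : (rcons u b \in map (rcons^~ c) s) = (b == c) && (u \in s).
    apply/mapP/andP => [[y ys /rcons_inj[-> ->]]|[/eqP -> us']]; first by [].
    by exists u.
  by rewrite !mp; case: b {mp}; rewrite /= ?orbF.
have cG : #|` G| = (size s).*2.+1.
  have <- : size L = (size s).*2.+1 by rewrite /= size_cat !size_map addnn.
  have -> : G = [fset x in L]%fset by apply/fsetP => u; rewrite LE in_fset.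
  by rewrite card_fseq undup_id.
have sG : ([fset x in s] `<=` G)%fset.
  apply/fsubsetP => x; rewrite !inE => /sE[xi H]; apply/GE; split; first by case/andP: xi.
  by move=> v /andP[vx _]; exact: H.
have -> : leaves G = (G `\` [fset x in s])%fset.
  apply/fsetP => x; rewrite /leaves !inE /= /is_leaf !Gr andbb.
  by case: (x \in G); rewrite ?andbF ?andbT.
by rewrite cardfsDS // cG card_fseq undup_id // -addnn -addSn addnK.
Qed.

End FiniteTree.
End Act.

(** When the truncated tree is infinite both sides fail: [act] never succeeds, and [fset_set] gives
    the empty tree, which has no leaf while k >= 1. *)
Lemma card_leaves_prune (R : realType) (kappa : word -> R) (ppp : word -> set R)
    (T : set word) (split : word -> bool) (k : nat) :
  (forall v, 0 <= kappa v) -> (forall x a, finite_set (ppp x `&` `[0, a])) ->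
  truncate kappa ppp T = split_tree split -> (1 <= k)%N ->
  #|` leaves (prune kappa ppp T)| = k <->
  exists h s, act split (fun x v => `[< hit kappa ppp x v >]) h [::] = Some s
    /\ (size s).+1 = k.
Proof.
move=> kappa0 pfin TE k1; rewrite /prune TE.
pose hitb (x v : word) := `[< hit kappa ppp x v >]; rewrite -/hitb.
have [fin|inf] := pselect (finite_set (split_tree split)); last first.
  split.
    move=> e; suff l0 : leaves (prune_finite kappa ppp (fset_set (split_tree split)))
      = fset0 by rewrite l0 cardfs0 in e; lia.
    have -> : fset_set (split_tree split) = fset0 by rewrite /fset_set; case: pselect.
    apply/fsetP => u; rewrite /leaves !inE /=.
    suff -> : (u \in prune_finite kappa ppp fset0) = false by [].
    apply/negP => /(prune_finiteP (cutE := pred0) kappa0 pfin _).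
    case=> [u'|]; last by rewrite inE.
    by split=> // -[x []]; rewrite /is_internal inE.
  move=> [h [s [Es _]]]; exfalso; apply: inf.
  by apply/(split_tree_finite _ hitb); exists h; rewrite Es.
have FE u : (u \in fset_set (split_tree split)) <-> split_tree split u.
  by rewrite in_fset_set // inE.
have cutP u := @edge_cutP split hitb _ FE u.
have prP := prune_finiteP kappa0 pfin (cutE := edge_cut split hitb (fset_set (split_tree split))).
have GE u := prP _ _ u.
have [h0 hN] := (split_tree_finite _ hitb).1 fin.
case E0: (act split hitb h0 [::]) hN => [s0|//] _.
rewrite (card_leaves_act FE E0); last first.
  move=> u; apply: GE => v; rewrite cutP; split=> -[x [? ? ? /asboolP ?]]; exists x; split=> //.
split=> [<-|[h [s [Es <-]]]]; first by exists h0, s0.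
by rewrite (act_inj E0 Es).
Qed.

(** * Infinite branches, and the size-biased tree as a family of splitting decisions *)

(** Konig's lemma for binary trees. It replaces a quantification over branches by countable
    operations, whence measurability later. *)
Lemma on_infinite_branchP (T : set word) v :
  (forall u w, prefix u w -> T w -> T u) ->
  on_infinite_branch T v <-> forall m, exists2 u : word, size u = m & T (v ++ u).
Proof.
move=> Tpre; split.
  move=> [b [Tb vb]] m; exists (drop (size v) (mkseq b (size v + m))).
    by rewrite size_drop size_mkseq addKn.
  rewrite [X in X ++ _](_ : v = take (size v) (mkseq b (size v + m))).
    by rewrite cat_take_drop.
  by rewrite /mkseq -map_take take_iota (minn_idPl (leq_addr _ _)).
pose Q w := forall m, exists2 u : word, size u = m & T (w ++ u).
move=> Qv; rewrite -/(Q v) in Qv.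
have QT w : Q w -> T w by move=> /(_ 0%N)[u /size0nil ->]; rewrite cats0.
have Qnext w : Q w -> Q (rcons w false) \/ Q (rcons w true).
  move=> Qw; apply: contrapT => /not_orP.
  rewrite /Q -!existsNP => -[[m0 h0] [m1 h1]].
  (* Were both children to fail, at lengths m0 and m1, an extension of w longer than both would pass
     through one of them and contradict its failure. *)
  have [[//|b u] [su] Tu] := Qw (maxn m0 m1).+1.
  have hb : forall m, (m <= maxn m0 m1)%N -> exists2 u : word, size u = m & T (rcons w b ++ u).
    move=> m mm; exists (take m u); first by rewrite size_takel // su.
    by apply: Tpre Tu; rewrite cat_rcons prefix_catr // eqxx prefix_cons eqxx prefix_take.
  by case: b {Tu} hb => hb; [apply: h1; apply: hb; rewrite leq_maxr|
    apply: h0; apply: hb; rewrite leq_maxl].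
(* Steps to the left child whenever it has extensions of every length, to the right child
   otherwise. *)
pose nxt w := rcons w (~~ `[< Q (rcons w false) >]).
have Qit m : Q (iter m nxt v).
  elim: m => //= m IH; rewrite {1}/nxt; case: asboolP => // n0.
  by case: (Qnext _ IH).
have sit m : size (iter m nxt v) = (size v + m)%N.
  by elim: m => [|m IH] /=; rewrite ?addn0 // size_rcons IH addnS.
have pit m k : prefix (iter m nxt v) (iter (k + m) nxt v).
  elim: k => [|k IH]; first exact: prefix_refl.
  by apply: (prefix_trans IH); rewrite addSn iterS; exact: prefix_rcons.
pose b m := nth false (iter m.+1 nxt v) m.
have bE m : mkseq b m = take m (iter m nxt v).
  apply: (@eq_from_nth _ false); first by rewrite size_mkseq size_takel // sit leq_addl.
  move=> i; rewrite size_mkseq => im; rewrite nth_mkseq // nth_take // /b.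
  have := pit i.+1 (m - i.+1)%N; rewrite subnK // => /prefix_takeE ->.
  by rewrite nth_take // sit; lia.
exists b; split=> [m|]; first by rewrite bE; apply: (Tpre _ (iter m nxt v)) (QT _ (Qit m)); exact: prefix_take.
by rewrite bE; have := pit 0%N (size v); rewrite addn0 => /prefix_takeE.
Qed.

Definition spine (v : word) : bool := v == nseq (size v) false.

Lemma spine_prefix u v : prefix u v -> spine v -> spine u.
Proof.
move=> uv /eqP /(congr1 (take (size u))).
by rewrite take_nseq ?size_prefix // -(prefix_takeE uv) => /eqP.
Qed.

Lemma spine_rcons v b : spine (rcons v b) = spine v && ~~ b.
Proof.
rewrite /spine size_rcons -addn1 nseqD cats1 eqseq_rcons; congr (_ && _).
by case: b.
Qed.

(* A word off the spine is [nseq i false ++ true :: u], the address of the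
   vertex u of G(i+1). *)
Definition branches (z : nat -> word -> nat) (v : word) : bool :=
  spine v || (z (index true v) (drop (index true v).+1 v) == 2%N).

Lemma not_spineP v : ~~ spine v ->
  v = nseq (index true v) false ++ true :: drop (index true v).+1 v.
Proof.
elim: v => [|[] v IH] //= h; first by rewrite drop0.
by rewrite {1}IH.
Qed.

Lemma index_nseq_false i (u : word) : index true (nseq i false ++ true :: u) = i.
Proof. by elim: i => //= i ->. Qed.

Lemma not_spine_cat i (u : word) : ~~ spine (nseq i false ++ true :: u).
Proof.
by elim: i => [|i IH] //; apply: contra IH; rewrite /spine /= => /eqP[{1}->].
Qed.

Lemma branches_cat z i (u : word) :
  branches z (nseq i false ++ true :: u) = (z i u == 2%N).
Proof.
rewrite /branches (negbTE (not_spine_cat _ _)) index_nseq_false /=.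
by rewrite drop_cat size_nseq ltnNge leqnSn /= subSnn /= drop0.
Qed.

Lemma spine_nseq i : spine (nseq i false).
Proof. by rewrite /spine size_nseq. Qed.

Lemma size_biasedE z : size_biased z = split_tree (branches z).
Proof.
apply/seteqP; split => [u [i [->|[u' gw ->]]] v vu|u Tu].
- rewrite /branches (spine_prefix _ (spine_nseq i)) //.
  by case/andP: vu.
- have [vs|vN] := boolP (spine v); first by rewrite /branches vs.
  move: vu; rewrite (not_spineP vN) branches_cat.
  set j := index _ _; set w := drop _ _ => vu.
  have [ij wu] : j = i /\ strict_prefix w u'.
    have ij : j = i.
      have := index_nseq_false i u'; have /andP[/prefixP[t ->] _] := vu.
      by rewrite -catA cat_cons index_nseq_false.
    split=> //; move: vu; rewrite ij /strict_prefix prefix_catr // eqxx prefix_cons eqxx /=.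
    by rewrite eqseq_cat // eqxx /= eqseq_cons eqxx.
  by rewrite ij gw.
- have [us|uN] := boolP (spine u).
    by exists (size u); left; exact/eqP.
  move: Tu; rewrite (not_spineP uN); set i := index _ _; set u' := drop _ _ => Tu.
  exists i; right; exists u' => // v vu; apply/eqP.
  rewrite -branches_cat; apply: Tu; move: vu; rewrite /strict_prefix prefix_catr // eqxx prefix_cons eqxx /=.
  by rewrite eqseq_cat // eqxx /= eqseq_cons eqxx.
Qed.

(** Making every self-marked vertex of an infinite branch childless has the same effect as cutting
    at the first one, since the later ones are no longer reached. *)
Lemma truncateE (R : realType) (kappa : word -> R) (ppp : word -> set R) (B : word -> bool) :
  truncate kappa ppp (split_tree B) = split_tree (fun v => B v &&
    ~~ `[< on_infinite_branch (split_tree B) v /\ hit kappa ppp v v >]).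
Proof.
apply/seteqP; split => u.
  move=> [Tu N] v vu; rewrite (Tu v vu) /=; apply/asboolPn => -[inf self].
  apply: N.
  (* The least length of a self-marked prefix of v designates the first self-marked vertex; v itself
     shows that such a length exists. *)
  have [m /andP[mv /asboolP selfm] min] := ex_minnP (ex_intro
    (fun m => (m <= size v)%N && `[< hit kappa ppp (take m v) (take m v) >]) (size v)
    (introT andP (conj (leqnn _) (introT (asboolP _)
       (eq_ind_r (fun w => hit kappa ppp w w) self (take_size v)))))).
  exists (take m v); last first.
    move: vu; rewrite !strict_prefixE => /andP[pvu lt].
    rewrite (prefix_trans (prefix_take _ _) pvu) size_takel //.
    exact: leq_ltn_trans lt.
  split=> //.
    have [b [Tb vb]] := inf; exists b; split=> //.
    by rewrite vb size_takel ?size_mkseq // /mkseq -map_take take_iota -/(mkseq _ _)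
      (minn_idPl _).
  move=> w wv selfw; move: (wv); rewrite strict_prefixE size_takel // => /andP[pw lt].
  have wE := prefix_takeE (prefix_trans pw (prefix_take _ _)).
  have := min (size w); rewrite -wE (leq_trans (ltnW lt) mv) /= asboolT //.
  by move=> /(_ isT); rewrite leqNgt lt.
move=> Tu; split; first by move=> v /Tu/andP[].
by move=> [v [inf self _] /Tu/andP[_ /asboolPn]]; apply.
Qed.

(** * Countable operations in an arbitrary sigma-algebra *)

Section SigmaAlgebra.
Variables (T : Type) (S : set (set T)).
Hypothesis sS : sigma_algebra setT S.

Lemma sigma_setC A : S A -> S (~` A).
Proof. by case: sS => _ + _; rewrite -setTD; apply. Qed.

Lemma sigma_set0 : S set0. Proof. by case: sS. Qed.

Lemma sigma_setT : S setT.
Proof. by rewrite -setC0; apply: sigma_setC; exact: sigma_set0. Qed.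

Lemma sigma_bigcup (I : countType) (D : set I) (F : I -> set T) :
  (forall i, D i -> S (F i)) -> S (\bigcup_(i in D) F i).
Proof.
move=> SF; have -> : \bigcup_(i in D) F i = \bigcup_(m : nat)
    (if @choice.unpickle I m is Some i then if `[< D i >] then F i else set0 else set0).
  apply/seteqP; split => [w [i Di Fi]|w [m _]].
    by exists (choice.pickle i) => //; rewrite choice.pickleK asboolT.
  by case: choice.unpickle => // i; case: asboolP => // Di Fi; exists i.
have [_ _] := sS; apply => m; case: choice.unpickle => [i|]; last exact: sigma_set0.
by case: asboolP => [/SF //|_]; exact: sigma_set0.
Qed.

Lemma sigma_bigcap (I : countType) (D : set I) (F : I -> set T) :
  (forall i, D i -> S (F i)) -> S (\bigcap_(i in D) F i).
Proof.
move=> SF; rewrite -[X in S X]setCK setC_bigcap; apply: sigma_setC.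
by apply: sigma_bigcup => i Di; apply: sigma_setC; exact: SF.
Qed.

Lemma sigma_setI A B : S A -> S B -> S (A `&` B).
Proof.
move=> SA SB; have -> : A `&` B = \bigcap_(b : bool) (if b then A else B).
  by apply/seteqP; split => [w [? ?] [] _|w H]; [| |split; [exact: (H true)|exact: (H false)]].
by apply: sigma_bigcap => -[].
Qed.

Lemma sigma_setU A B : S A -> S B -> S (A `|` B).
Proof.
by move=> SA SB; rewrite -[X in S X]setCK setCU; apply: sigma_setC;
  apply: sigma_setI; exact: sigma_setC.
Qed.

End SigmaAlgebra.

Lemma sigma_algebra_measurable_set d (T : measurableType d) :
  sigma_algebra setT (@measurable d T).
Proof.
split=> [|A mA|A mA]; first exact: measurable0.
  by rewrite setTD; exact: measurableC.
exact: bigcupT_measurable.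
Qed.

Lemma sigma_algebra_gen (T : Type) (G : set (set T)) : sigma_algebra setT <<s G >>.
Proof. exact: smallest_sigma_algebra. Qed.

(** * Limits of exponentials and of probabilities *)

Section Limits.
Variable R : realType.

(** Squeezed by x/(1 + x) <= 1 - exp(-x) <= x, used on both numerator and denominator. *)
Lemma cvg_expR_ratio (a b : R) : 0 <= a -> 0 < b ->
  (1 - expR (- (a * m.+1%:R^-1))) / (1 - expR (- (b * m.+1%:R^-1)))
    @[m --> \oo] --> a / b.
Proof.
move=> a0 b0.
have d0 m : 0 < m.+1%:R^-1 :> R by rewrite invr_gt0 ltr0Sn.
have up (x : R) : 1 - expR (- x) <= x.
  by rewrite lerBlDr -lerBlDl; have := expR_ge1Dx (- x); lra.
have lo (x : R) : 0 <= x -> x / (1 + x) <= 1 - expR (- x).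
  move=> x0; have x1 : 0 < 1 + x by lra.
  have -> : x / (1 + x) = 1 - (1 + x)^-1 by field; rewrite gt_eqF.
  by rewrite lerB // expRN lef_pV2 ?posrE ?expR_gt0 // expR_ge1Dx.
have dlim : (m.+1%:R^-1 : R) @[m --> \oo] --> (0 : R) by exact: cvg_harmonic.
have lim (f : R -> R) : {for 0, continuous f} -> f m.+1%:R^-1 @[m --> \oo] --> f 0.
  by move=> cf; apply: (cvg_comp _ _ dlim).
apply: (@squeeze_cvgr _ _ _ _ (fun m => a / (b * (1 + a * m.+1%:R^-1)))
   (fun m => a * (1 + b * m.+1%:R^-1) / b)).
- apply: nearW => m; have dm := d0 m; set e := _^-1 in dm *.
  have ae0 : 0 <= a * e by rewrite mulr_ge0 // ltW.
  have be0 : 0 < b * e by rewrite mulr_gt0.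
  have q0 : 0 < 1 - expR (- (b * e)).
    by apply: lt_le_trans (lo _ (ltW be0)); rewrite divr_gt0 //; lra.
  apply/andP; split.
    rewrite ler_pdivlMr //; apply: le_trans (lo _ ae0).
    have -> : a * e / (1 + a * e) = a / (b * (1 + a * e)) * (b * e).
      by field; rewrite !gt_eqF //; lra.
    by rewrite ler_wpM2l // divr_ge0 // mulr_ge0 //; lra.
  rewrite ler_pdivrMr //; apply: le_trans (up _) _.
  have -> : a * e = a * (1 + b * e) / b * (b * e / (1 + b * e)).
    by field; rewrite !gt_eqF //; lra.
  apply: ler_wpM2l; last by apply: lo; exact: ltW.
  by rewrite divr_ge0 // ?mulr_ge0 //; lra.
- have := @lim (fun x => a / (b * (1 + a * x))); rewrite mulr0 addr0 mulr1; apply.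
  apply: cvgM; first exact: cvg_cst.
  apply: cvgV; first by rewrite mulr0 addr0 mulr1 gt_eqF.
  apply: cvgM; first exact: cvg_cst.
  apply: cvgD; first exact: cvg_cst.
  by apply: cvgM; [exact: cvg_cst|exact: cvg_id].
- have := @lim (fun x => a * (1 + b * x) / b); rewrite mulr0 addr0 mulr1; apply.
  apply: cvgM; last exact: cvg_cst.
  apply: cvgM; first exact: cvg_cst.
  apply: cvgD; first exact: cvg_cst.
  by apply: cvgM; [exact: cvg_cst|exact: cvg_id].
Qed.

Lemma cvg_expR_linear (b : R) : 0 < b ->
  expR (- (b * m.+1%:R)) @[m --> \oo] --> (0 : R).
Proof.
move=> b0.
apply: (@squeeze_cvgr _ _ _ _ (fun=> 0) (fun m => b^-1 * m.+1%:R^-1)).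
- apply: nearW => m; rewrite expR_ge0 /= expRN -invfM lef_pV2 ?posrE ?expR_gt0 //.
    by apply: le_trans (expR_ge1Dx _); rewrite lerDr.
  by rewrite mulr_gt0.
- exact: cvg_cst.
- rewrite -[X in _ --> X](mulr0 b^-1); apply: cvgM; first exact: cvg_cst.
  exact: cvg_harmonic.
Qed.

(* The Laplace transform at a of the exponential law of parameter 2, the
   variable being rounded down to a multiple of 1/(m+1) and cut at m+1. *)
Lemma cvg_laplace_discretized (a : R) : 0 <= a ->
  \sum_(j < m.+1 ^ 2) (expR (- (2 * (j%:R * m.+1%:R^-1)))
     - expR (- (2 * (j.+1%:R * m.+1%:R^-1)))) * expR (- (a * (j%:R * m.+1%:R^-1)))
    @[m --> \oo] --> 2 / (2 + a).
Proof.
move=> a0; have b0 : 0 < 2 + a by lra.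
have -> : 2 / (2 + a) = 2 / (2 + a) * (1 - 0) :> R by rewrite subr0 mulr1.
have sumE (m : nat) : \sum_(j < m.+1 ^ 2) (expR (- (2 * (j%:R * m.+1%:R^-1)))
     - expR (- (2 * (j.+1%:R * m.+1%:R^-1)))) * expR (- (a * (j%:R * m.+1%:R^-1)))
  = (1 - expR (- (2 * m.+1%:R^-1))) / (1 - expR (- ((2 + a) * m.+1%:R^-1)))
      * (1 - expR (- ((2 + a) * m.+1%:R))).
  have d0 : 0 < m.+1%:R^-1 :> R by rewrite invr_gt0 ltr0Sn.
  (* The terms are (1 - exp(-2d)) q^j, a geometric progression. As (m+1)^2 cells of width 1/(m+1)
     reach up to m+1, the remainder is q^((m+1)^2) = exp(-(2+a)(m+1)). *)
  set d : R := _^-1 in d0 *; set q := expR (- ((2 + a) * d)).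
  have qlt1 : q < 1 by rewrite /q -[ltRHS]expR0 ltr_expR oppr_lt0 mulr_gt0.
  have termE (j : nat) : (expR (- (2 * (j%:R * d))) - expR (- (2 * (j.+1%:R * d))))
      * expR (- (a * (j%:R * d))) = (1 - expR (- (2 * d))) * q ^+ j.
    rewrite -expRM_natl !mulrBl -!expRD mul1r.
    by congr (expR _ - expR _); rewrite -?natr1; ring.
  rewrite (eq_bigr _ (fun (j : 'I_(m.+1 ^ 2)) _ => termE j)) -mulr_sumr.
  have -> : \sum_(j < m.+1 ^ 2) q ^+ j = (1 - q ^+ (m.+1 ^ 2)) / (1 - q).
    apply: (canRL (mulfK _)); first by rewrite subr_eq0 eq_sym lt_eqF.
    by rewrite -[LHS]opprK -mulrN opprB mulrC -subrX1 opprB.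
  rewrite mulrA mulrAC; congr (_ * (_ - _)); rewrite /q -expRM_natl; congr expR.
  by rewrite natrX /d; field; rewrite addrC natr1 pnatr_eq0.
under eq_cvg do rewrite sumE.
apply: cvgM (cvg_expR_ratio (ler0n R 2) b0) _.
by apply: cvgB (cvg_expR_linear b0); exact: cvg_cst.
Qed.

End Limits.

Section EventuallyConstant.
Variables (R : realType) (d : measure_display) (T : measurableType d).
Variable P : probability T R.

(** The limits inferior and superior of A both equal B; continuity of P along the monotone sequences
    [L] and [U] squeezes P (A m). *)
Lemma cvg_probability_eventually (A : nat -> set T) (B : set T) :
  (forall m, measurable (A m)) -> (forall w, \forall m \near \oo, A m w <-> B w) ->
  measurable B /\ P (A m) @[m --> \oo] --> P B.
Proof.
move=> mA AB.
pose L m := \bigcap_(k in [set k | (m <= k)%N]) A k.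
pose U m := \bigcup_(k in [set k | (m <= k)%N]) A k.
have mL m : measurable (L m) by apply: bigcap_measurable; [exists m => /=|].
have mU m : measurable (U m) by apply: bigcup_measurable.
have BL : \bigcup_m L m = B.
  apply/seteqP; split => w.
    move=> [m _ Lw]; have [N _ H] := AB w.
    apply/(H (maxn m N)); first by rewrite /= leq_maxr.
    by apply: Lw; rewrite /= leq_maxl.
  by move=> Bw; have [N _ H] := AB w; exists N => // k /= Nk; apply/H.
have BU : \bigcap_m U m = B.
  apply/seteqP; split => w.
    move=> Uw; have [N _ H] := AB w.
    by have [k /= Nk Ak] := Uw N I; apply/(H k).
  move=> Bw m _; have [N _ H] := AB w; exists (maxn m N); first by rewrite /= leq_maxl.
  by apply/H => //=; rewrite leq_maxr.
have mB : measurable B by rewrite -BL; exact: bigcupT_measurable.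
split=> //.
apply: (@squeeze_cvge _ _ _ _ (P \o L) _ (P \o U)).
- apply: nearW => m /=; apply/andP; split; apply: le_measure; rewrite ?inE //.
    by move=> w; apply => /=.
  by move=> w Aw; exists m => /=.
- rewrite -[X in _ --> P X]BL; apply: nondecreasing_cvg_mu => //; rewrite ?BL //.
  by move=> m k mk; apply/subsetPset => w Lw j /= kj; apply: Lw => /=; exact: leq_trans kj.
- rewrite -[X in _ --> P X]BU; apply: nonincreasing_cvg_mu => //; rewrite ?BU //.
    by rewrite (le_lt_trans (probability_le1 P _)) // ltry.
  move=> m k mk; apply/subsetPset => w [j /= kj Aj]; exists j => //=.
  exact: leq_trans kj.
Qed.

End EventuallyConstant.

(** * Marks on the edges, with discretized lengths *)

Lemma near_all_in (T : eqType) (s : seq T) (Q : T -> nat -> Prop) :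
  (forall x, x \in s -> \forall m \near \oo, Q x m) ->
  \forall m \near \oo, forall x, x \in s -> Q x m.
Proof.
elim: s => [|a s IH] H; first exact: nearW.
have Ha := H a (mem_head _ _).
have Hs : \forall m \near \oo, forall x, x \in s -> Q x m.
  by apply: IH => x xs; apply: H; rewrite inE xs orbT.
near=> m => x; rewrite inE => /orP[/eqP ->|]; first by near: m.
by move: x; near: m.
Unshelve. all: by end_near. Qed.

Lemma near_harmonic_lt (R : realType) (c e : R) : 0 < e ->
  \forall m \near \oo, c * m.+1%:R^-1 < e.
Proof.
move=> e0; have : c * m.+1%:R^-1 @[m --> \oo] --> c * (0 : R).
  by apply: cvgM; [exact: cvg_cst|exact: cvg_harmonic].
by rewrite mulr0 => /cvgr_lt; exact.
Qed.

Section GridProbability.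
Variables (R : realType) (d : measure_display) (Omega : measurableType d).
Variables (P : probability Omega R) (n : nat).
Variables (offspring : nat -> word -> {RV P >-> nat}) (kappa : word -> {RV P >-> R}).
Variable ppp : word -> Omega -> set R.
Hypothesis model : pruning_model n offspring kappa ppp.

Lemma length_cdf v (x : R) : 0 <= x ->
  P (kappa v @^-1` `[0, x]) = (1 - expR (- (2 * x)))%:E.
Proof.
rewrite le_eqVlt => /orP[/eqP <-|x0].
  rewrite mulr0 oppr0 expR0 subrr set_itv1.
  rewrite [X in P X](_ : _ = set0) ?measure0 //.
  apply/seteqP; split => w //= e; have := kappa_gt0 model v w.
  by rewrite e ltxx.
have := kappa_law model v (measurable_itv `[0, x]).
by rewrite exponential_prob_itv0c // mulNr.
Qed.

Lemma length_itv_prob v (x y : R) : 0 <= x -> x <= y ->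
  P (kappa v @^-1` `]x, y]) = (expR (- (2 * x)) - expR (- (2 * y)))%:E.
Proof.
move=> x0 xy; have mk (i : interval R) : measurable (kappa v @^-1` [set` i]).
  by rewrite -[X in measurable X]setTI; exact: measurable_funP.
have : P (kappa v @^-1` `[0, y]) =
    (P (kappa v @^-1` `[0%R, x]) + P (kappa v @^-1` `]x, y]))%E.
  rewrite -measureU //; last first.
    apply/seteqP; split => w //= []; rewrite !in_itv /= => /andP[_ h] /andP[].
    by rewrite ltNge h.
  congr (P _); rewrite -preimage_setU; congr (_ @^-1` _).
  apply/seteqP; split => z /=; rewrite !in_itv /=.
    move=> /andP[z0 zy]; case: (leP z x) => zx; [left|right]; first by rewrite z0.
    by rewrite zy.
  by case=> /andP[h1 h2]; apply/andP; split; lra.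
rewrite !length_cdf //; last exact: le_trans xy.
rewrite -[P (_ @^-1` `]_, _])]fineK ?fin_num_measure // -EFinD => -[e].
by congr (_%:E); lra.
Qed.

Lemma count_is0 (N : Omega -> set R) (A : set R) :
  count_is N A 0 = [set w | N w `&` A = set0].
Proof.
apply/seteqP; split => w; rewrite /count_is /= II0.
  by rewrite card_eq0 => /eqP.
by move=> ->; exact: card_eq00.
Qed.

Lemma no_mark_prob x (a l : R) : 0 <= a -> 0 <= l ->
  P (count_is (ppp x) `[a, a + l[ 0) = (expR (- (l / n%:R)))%:E.
Proof.
move=> a0 l0; have mE : lebesgue_measure (`[a, a + l[ : set R) = l%:E.
  rewrite lebesgue_measure_itv /= lte_fin ltrDl.
  case: ifPn => [_|]; first by rewrite -EFinB addrAC subrr add0r.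
  by rewrite -leNgt => l0'; congr (_%:E); apply/eqP; rewrite eq_le l0.
rewrite (ppp_law (ppp_rate model x)) //; last by rewrite mE ltry.
  by rewrite mE /poisson_weight expr0 fact0 divr1 mul1r /= mulrC.
by move=> z /=; rewrite !in_itv /= => /andP[h _]; rewrite andbT (le_trans a0).
Qed.

Lemma no_mark0 x : count_is (ppp x) set0 0 = setT.
Proof. by rewrite count_is0; apply/seteqP; split => w //= _; rewrite setI0. Qed.

Lemma no_mark_indep x (I : finType) (A : I -> set R) :
  (forall i, measurable (A i)) -> trivIset setT A ->
  P (\bigcap_i count_is (ppp x) (A i) 0) = (\prod_(i : I) P (count_is (ppp x) (A i) 0))%E.
Proof.
move=> mA tA.
have := ppp_indep (ppp_rate model x) (A := fun i : 'I_#|I| => A (enum_val i)) (fun=> 0%N).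
move=> indep; rewrite [RHS](reindex _ (onW_bij _ (@enum_val_bij I))) -indep //.
- congr (P _); apply/seteqP; split => w H i _; first exact: H.
  by have := H (enum_rank i) Logic.I; rewrite enum_rankK.
- by apply/trivIsetP => i j _ _ ij; move/trivIsetP: tA; apply => //; rewrite (inj_eq enum_val_inj).
Qed.

Definition hit_event (x v : word) : set Omega :=
  [set w | hit (fun v => kappa v w) (fun x => ppp x w) x v].

Definition bit_event (b : nat * word) : set Omega := offspring b.1 b.2 @^-1` [set 2%N].

Lemma measurable_bit b : measurable (bit_event b).
Proof. by rewrite -[X in measurable X]setTI; exact: measurable_funP. Qed.

Lemma bit_event_prob b : P (bit_event b) = (2^-1)%:E.
Proof. by case: (offspring_law model b.1 b.2). Qed.

Section Grid.
(** [s v] is the set of processes required to leave no mark on e_v, [X] contains them all, and [U]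
    lists the offspring numbers required to be 2. *)
Variables (E X : {fset word}) (s : word -> {fset word}) (U : {fset nat * word}).
Hypothesis sX : forall v x, x \in s v -> x \in X.
Hypothesis s_prefix : forall v x, x \in s v -> prefix v x.
Variables (M : nat) (dl : R).
Hypothesis dl_gt0 : 0 < dl.

Implicit Type g : {ffun E -> 'I_M}.

Definition grid g (v : word) : R :=
  if insub v is Some e then (g e : nat)%:R * dl else 0.

Lemma grid_ge0 g v : 0 <= grid g v.
Proof. by rewrite /grid; case: insub => // e; rewrite mulr_ge0 // ltW. Qed.

Lemma grid_val g (e : E) : grid g (val e) = (g e : nat)%:R * dl.
Proof. by rewrite /grid valK. Qed.

(** Open on the left: lengths are positive, so each length within the range of the grid lies in
    exactly one cell. *)
Definition cell g v : set Omega := kappa v @^-1` `]grid g v, grid g v + dl].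

(** The place of e_v according to the rounded lengths. For fixed g it is a deterministic interval,
    to which the Poisson law applies without conditioning. *)
Definition gap g x v : set R :=
  if x \in s v then `[edge_bottom (grid g) v, edge_bottom (grid g) v + grid g v[%classic
  else set0.

Definition no_mark g x : set Omega :=
  \bigcap_(e : E) count_is (ppp x) (gap g x (val e)) 0.

Definition slice g : set Omega :=
  [set w | [/\ forall v, v \in E -> cell g v w, forall x, x \in X -> no_mark g x w
             & forall b, b \in U -> bit_event b w]].

Lemma measurable_gap g x v : measurable (gap g x v).
Proof. by rewrite /gap; case: ifP. Qed.

Lemma measurable_cell g v : measurable (cell g v).
Proof. by rewrite -[X in measurable X]setTI; exact: measurable_funP. Qed.

Lemma measurable_no_mark g x : measurable (no_mark g x).
Proof.
apply: (sigma_bigcap (@sigma_algebra_measurable_set _ Omega)) => e _.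
by apply: (ppp_measurable (ppp_rate model x)); exact: measurable_gap.
Qed.

Lemma sigma_no_mark g x : sigma_of_points (ppp x) (no_mark g x).
Proof.
apply: (sigma_bigcap (@sigma_algebra_gen _ _)) => e _.
apply: sub_gen_smallest; exists (gap g x (val e)), 0%N; split => //.
exact: measurable_gap.
Qed.

Lemma measurable_slice g : measurable (slice g).
Proof.
have -> : slice g = (\bigcap_(v in [set` E]) cell g v) `&`
   (\bigcap_(x in [set` X]) no_mark g x) `&` (\bigcap_(b in [set` U]) bit_event b).
  by apply/seteqP; split => w; [case|case => -[]].
have sm := @sigma_algebra_measurable_set _ Omega.
apply: (sigma_setI sm); first apply: (sigma_setI sm).
- by apply: (sigma_bigcap sm) => v _; exact: measurable_cell.
- by apply: (sigma_bigcap sm) => x _; exact: measurable_no_mark.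
- by apply: (sigma_bigcap sm) => b _; exact: measurable_bit.
Qed.

Lemma cell_prob g (e : E) : P (cell g (val e)) =
  (expR (- (2 * ((g e : nat)%:R * dl))) - expR (- (2 * ((g e).+1%:R * dl))))%:E.
Proof.
rewrite /cell grid_val length_itv_prob ?lerDl ?(ltW dl_gt0) //.
  by congr ((_ - expR (- (2 * _)))%:E); rewrite -natr1 mulrDl mul1r.
by rewrite mulr_ge0 // ltW.
Qed.

(** The edges that x must miss all lie on the branch from x to star, hence occupy disjoint
    intervals, over which the process is independent. *)
Lemma no_mark_gap_prob g x : P (no_mark g x) =
  (\prod_(e : E) (if x \in s (val e) then expR (- ((g e : nat)%:R * dl / n%:R)) else 1))%:E.
Proof.
rewrite /no_mark no_mark_indep; last 2 first.
- by move=> e; exact: measurable_gap.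
- apply/trivIsetP => e e' _ _ ne; rewrite /gap.
  case: ifPn => xe; last by rewrite set0I.
  case: ifPn => xe'; last by rewrite setI0.
  have disj u v : prefix u x -> prefix v x -> (size u < size v)%N ->
      `[edge_bottom (grid g) u, edge_bottom (grid g) u + grid g u[%classic `&`
      `[edge_bottom (grid g) v, edge_bottom (grid g) v + grid g v[%classic = set0.
    move=> ux vx lt; have uv : strict_prefix u v.
      by rewrite strict_prefixE lt (prefix_comparable ux vx) // ltnW.
    have h := edge_top_le_bottom (grid_ge0 g) uv.
    apply/seteqP; split => p //=; rewrite !in_itv /= => -[/andP[_ h1] /andP[h2 _]].
    by have := lt_le_trans h1 (le_trans h h2); rewrite ltxx.
  case: (ltngtP (size (val e)) (size (val e'))) => sz.
  + by apply: disj => //; exact: s_prefix.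
  + by rewrite setIC; apply: disj => //; exact: s_prefix.
  + move: ne; rewrite -(inj_eq val_inj).
    by rewrite (prefix_takeE (s_prefix xe)) (prefix_takeE (s_prefix xe')) sz eqxx.
rewrite -prodEFin; apply: eq_bigr => e _; rewrite /gap.
case: ifP => _; last by rewrite no_mark0 probability_setT.
rewrite no_mark_prob ?grid_ge0 //; first by rewrite grid_val.
exact: (edge_bottom_ge0 (grid_ge0 g)).
Qed.

Lemma prod_no_mark_gap (e : E) (q : R) :
  \prod_(x <- X) (if x \in s (val e) then q else 1) = q ^+ #|` s (val e)|.
Proof.
rewrite -big_mkcond /= big_const_seq -Monoid.iteropE; congr (q ^+ _).
rewrite -size_filter; apply: perm_size; apply: uniq_perm; rewrite ?filter_uniq ?fset_uniq //.
by move=> x; rewrite mem_filter andb_idr // => /sX.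
Qed.

Lemma slice_prob g : P (slice g) = ((\prod_(e : E)
    ((expR (- (2 * ((g e : nat)%:R * dl))) - expR (- (2 * ((g e).+1%:R * dl))))
      * expR (- (#|` s (val e)|%:R / n%:R * ((g e : nat)%:R * dl)))))
    * 2^-1 ^+ #|` U|)%:E.
Proof.
(* One event for each independent component of the model; [L] lists the components involved, without
   repetition. *)
pose evt (j : (nat * word) + (word + word)) : set Omega :=
  match j with
  | inl b => bit_event b
  | inr (inl v) => cell g v
  | inr (inr x) => no_mark g x
  end.
pose L : seq ((nat * word) + (word + word)) :=
  map inl (enum_fset U) ++ map (inr \o inl) (enum_fset E) ++
  map (inr \o inr) (enum_fset X).
have LU b : (inl b \in L) = (b \in U).
  rewrite !mem_cat mem_map; last by move=> ? ? [].
  by rewrite -[RHS]orbF; congr (_ || _); apply/negbTE/negP => /orP[] /mapP[].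
have LE v : (inr (inl v) \in L) = (v \in E).
  rewrite !mem_cat mem_map; last by move=> ? ? [].
  have -> : ((inr (inl v) : (nat * word) + (word + word)) \in map inl (enum_fset U)) = false by apply/negbTE/negP => /mapP[].
  by rewrite orFb -[RHS]orbF; congr (_ || _); apply/negbTE/negP => /mapP[].
have LX x : (inr (inr x) \in L) = (x \in X).
  rewrite !mem_cat [X in _ || (_ || X)]mem_map; last by move=> ? ? [].
  have -> : ((inr (inr x) : (nat * word) + (word + word)) \in map inl (enum_fset U)) = false by apply/negbTE/negP => /mapP[].
  have -> : ((inr (inr x) : (nat * word) + (word + word)) \in map (inr \o inl) (enum_fset E)) = false.
    by apply/negbTE/negP => /mapP[].
  by [].
have uL : uniq L.
  rewrite /L !cat_uniq !map_inj_uniq ?fset_uniq //=; try by move=> ? ? [].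
  rewrite andbT; apply/andP; split; apply/hasPn => j.
    by rewrite mem_cat => /orP[] /mapP[y _ ->]; apply/negP => /mapP[].
  by move=> /mapP[y _ ->]; apply/negP => /mapP[].
have -> : slice g = \bigcap_(j in [set` [fset j in L]%fset]) evt j.
  apply/seteqP; split => [w [hE hX hU] [b|[v|x]] /=|w H].
  - by rewrite in_fset => jL; apply: hU; rewrite -LU.
  - by rewrite in_fset => jL; apply: hE; rewrite -LE.
  - by rewrite in_fset => jL; apply: hX; rewrite -LX.
  - split=> [v vE|x xX|b bU].
    + by apply: (H (inr (inl v))); rewrite /= in_fset LE.
    + by apply: (H (inr (inr x))); rewrite /= in_fset LX.
    + by apply: (H (inl b)); rewrite /= in_fset LU.
rewrite (model_indep model); last first.
  move=> [b|[v|x]] _ /=.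
  - by exists [set 2%N].
  - by exists (`]grid g v, grid g v + dl]%classic) => //; exact: measurable_itv.
  - exact: sigma_no_mark.
rewrite (perm_big L) /=; last first.
  by apply: uniq_perm => [||j]; rewrite ?fset_uniq ?in_fset.
rewrite !big_cat !big_map /=.
under eq_bigr do rewrite bit_event_prob.
rewrite [X in (_ * (X * _))%E]big_seq_fsetE /=.
under [X in (_ * (X * _))%E]eq_bigr do rewrite cell_prob.
under [X in (_ * (_ * X))%E]eq_bigr do rewrite no_mark_gap_prob.
rewrite !prodEFin -!EFinM; congr (_%:E); rewrite mulrC; congr (_ * _); last first.
  by rewrite big_const_seq count_predT -Monoid.iteropE.
(* Exchanging the products over processes and over edges gathers on e_v one factor for each process
   in [s v]. *)
rewrite exchange_big /= -big_split /=; apply: eq_bigr => e _; congr (_ * _).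
rewrite prod_no_mark_gap -expRM_natl; congr expR.
by rewrite mulrN mulrA mulrAC.
Qed.

End Grid.
End GridProbability.

Lemma grid_index (R : realType) (K dl : R) (M : nat) : 0 < K -> K <= M%:R * dl ->
  exists j : 'I_M, (j : nat)%:R * dl < K <= (j : nat)%:R * dl + dl.
Proof.
move=> K0; elim: M => [|M IH]; first by rewrite mul0r leNgt K0.
case: (leP K (M%:R * dl)) => [/IH[j Hj] _|lt le].
  by exists (widen_ord (leqnSn M) j).
by exists ord_max; rewrite lt /= -[X in _ + X]mul1r -mulrDl natr1.
Qed.

(** * Exact probability that given processes miss given edges *)

Section Avoidance.
Variables (R : realType) (d : measure_display) (Omega : measurableType d).
Variables (P : probability Omega R) (n : nat).
Variables (offspring : nat -> word -> {RV P >-> nat}) (kappa : word -> {RV P >-> R}).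
Variable ppp : word -> Omega -> set R.
Hypothesis model : pruning_model n offspring kappa ppp.

Section Grid.
Variables (E X : {fset word}) (s : word -> {fset word}) (U : {fset nat * word}).
(** The place of e_v depends on the lengths of all the edges below it, which must therefore be
    rounded too. *)
Hypothesis E_prefix : forall u v, v \in E -> prefix u v -> u \in E.
Hypothesis sX : forall v x, x \in s v -> x \in X.
Hypothesis s_prefix : forall v x, x \in s v -> prefix v x.

Definition avoid : set Omega :=
  [set w | (forall v x, v \in E -> x \in s v -> ~ hit_event kappa ppp x v w) /\
           (forall b, b \in U -> bit_event offspring b w)].

Definition slices (m : nat) : set Omega :=
  \bigcup_g slice offspring kappa ppp X s U (M := m.+1 ^ 2) m.+1%:R^-1 (E := E) g.

Let dl_gt0 m : 0 < m.+1%:R^-1 :> R.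
Proof. by rewrite invr_gt0 ltr0Sn. Qed.

Lemma cell_index_uniq (K dl : R) (a b : nat) : 0 < dl ->
  a%:R * dl < K <= a%:R * dl + dl -> b%:R * dl < K <= b%:R * dl + dl -> a = b.
Proof.
move=> dl0 /andP[a1 a2] /andP[b1 b2].
have le (i j : nat) : i%:R * dl < j%:R * dl + dl -> (i <= j)%N.
  by rewrite -[X in _ + X]mul1r -mulrDl natr1 ltr_pM2r // ltr_nat ltnS.
apply/eqP; rewrite eqn_leq (le _ _ (lt_le_trans a1 b2)).
exact: le _ _ (lt_le_trans b1 a2).
Qed.

Lemma measurable_slices m : measurable (slices m).
Proof.
apply: (sigma_bigcup (@sigma_algebra_measurable_set _ Omega)) => g _.
exact: (measurable_slice model).
Qed.

(** Slices with distinct g are disjoint, so the probability is a sum over g of products over edges;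
    distributivity turns it into a product of one-edge sums. *)
Lemma slices_prob m : P (slices m) = ((\prod_(e : E) \sum_(j < m.+1 ^ 2)
    ((expR (- (2 * (j%:R * m.+1%:R^-1))) - expR (- (2 * (j.+1%:R * m.+1%:R^-1))))
      * expR (- (#|` s (val e)|%:R / n%:R * (j%:R * m.+1%:R^-1)))))
    * 2^-1 ^+ #|` U|)%:E.
Proof.
rewrite /slices measure_fin_bigcup; last 3 first.
- exact: finite_finset.
- apply/trivIsetP => g g' _ _ ne; apply/seteqP; split => w //=.
  move=> [[c _ _] [c' _ _]]; move/eqP: ne; apply; apply/ffunP => e; apply/val_inj.
  have := c _ (valP e); have := c' _ (valP e).
  rewrite /cell /= !in_itv /= !grid_val => h h'.
  exact: cell_index_uniq h' h.
- by move=> g _; exact: (measurable_slice model).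
rewrite fsbig_finite //=.
rewrite (perm_big (index_enum _)); last first.
  apply: uniq_perm; rewrite ?fset_uniq ?index_enum_uniq // => g.
  by rewrite mem_index_enum -[LHS]/(g \in fset_set setT) in_fset_set ?in_setT //; exact: finite_finset.
under eq_bigr do rewrite (slice_prob model U sX s_prefix (dl_gt0 m)).
rewrite sumEFin -mulr_suml; congr ((_ * _)%:E).
by rewrite bigA_distr_bigA.
Qed.

Lemma edge_bottom_grid (K G : word -> R) (e : R) v :
  (forall u, u \in E -> G u <= K u <= G u + e) -> v \in E ->
  edge_bottom G v <= edge_bottom K v <= edge_bottom G v + (size v)%:R * e.
Proof.
move=> GK vE; have tE i : take i v \in E by apply: E_prefix vE _; exact: prefix_take.
apply/andP; split; first by apply: ler_sum => i _; case/andP: (GK _ (tE i)).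
have -> : (size v)%:R * e = \sum_(i < size v) e.
  by rewrite sumr_const card_ord mulr_natl.
by rewrite -big_split; apply: ler_sum => i _; case/andP: (GK _ (tE i)).
Qed.

(* The processes being locally finite, rounding the lengths down by little
   enough moves no mark across an end of an edge. *)
Lemma slices_near w : \forall m \near \oo, slices m w <-> avoid w.
Proof.
pose K v := kappa v w.
have K0 v : 0 < K v by exact: (kappa_gt0 model).
pose pts v x := enum_fset (fset_set (ppp x w `&` `[0, edge_top K v])).
have ptsE v x p : ppp x w p -> p <= edge_top K v -> p \in pts v x.
  move=> xp pt; rewrite -[_ \in _]/(p \in fset_set _) in_fset_set.
    rewrite inE; split=> //=; rewrite in_itv /= pt andbT.
    by have := ppp_support (ppp_rate model x) xp; rewrite /= in_itv /= andbT.
  exact: ppp_locally_finite (ppp_rate model x) _ _.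
have near1 : \forall m \near \oo, forall v, v \in enum_fset E -> K v <= m.+1%:R.
  apply: near_all_in => v _.
  near=> m; apply: (@le_trans _ _ m%:R); last by rewrite ler_nat.
  by near: m; exact: nbhs_infty_ger.
(* The ends of e_v move by at most (size v).+1 mesh widths, one for each edge up to e_v. Eventually
   this is less than the distance from each point to the ends lying above it. *)
have near2 : \forall m \near \oo, forall v, v \in enum_fset E -> forall x, x \in enum_fset (s v) ->
    forall p, p \in pts v x ->
      (p < edge_bottom K v -> (size v).+1%:R * m.+1%:R^-1 < edge_bottom K v - p) /\
      (p < edge_top K v -> (size v).+1%:R * m.+1%:R^-1 < edge_top K v - p).
  apply: near_all_in => v vE; apply: near_all_in => x xs; apply: near_all_in => p _.
  have h (c : R) : \forall m \near \oo, p < c -> (size v).+1%:R * m.+1%:R^-1 < c - p.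
    case: (ltP p c) => pc; last by apply: nearW.
    have cp : 0 < c - p by rewrite subr_gt0.
    by near=> m => _; near: m; exact: near_harmonic_lt.
  by near=> m; split; near: m; exact: h.
near=> m.
have n1 : forall v, v \in E -> K v <= m.+1%:R by near: m.
have n2 : forall v, v \in E -> forall x, x \in s v -> forall p, p \in pts v x ->
      (p < edge_bottom K v -> (size v).+1%:R * m.+1%:R^-1 < edge_bottom K v - p) /\
      (p < edge_top K v -> (size v).+1%:R * m.+1%:R^-1 < edge_top K v - p).
  by near: m.
have dl0 := dl_gt0 m; set dl := _^-1 in dl0 n2.
have key (g : {ffun E -> 'I_(m.+1 ^ 2)}) :
    (forall v, v \in E -> cell kappa dl g v w) ->
    (forall x, x \in X -> no_mark ppp s dl g x w) <->
    (forall v x, v \in E -> x \in s v -> ~ hit_event kappa ppp x v w).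
  move=> cg; have GK u : u \in E -> grid dl g u <= K u <= grid dl g u + dl.
    by move=> /cg; rewrite /cell /= in_itv /= => /andP[/ltW -> ->].
  have bG v : v \in E -> edge_bottom (grid dl g) v <= edge_bottom K v /\
      edge_bottom K v <= edge_bottom (grid dl g) v + (size v).+1%:R * dl /\
      edge_top (grid dl g) v <= edge_top K v /\
      edge_top K v <= edge_top (grid dl g) v + (size v).+1%:R * dl.
    move=> vE; have /andP[h1 h2] := edge_bottom_grid GK vE.
    have /andP[h3 h4] := GK _ vE.
    rewrite /edge_top -natr1 mulrDl mul1r; split=> //; split; first by lra.
    by split; [exact: lerD|lra].
  (* A point of the true edge stays on the rounded one: the lower end only moves down, and the upper
     end remains above the point. Conversely, a point of the rounded edge cannot lie below the true
     lower end. *)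
  split=> [nm v x vE xs [p xp /andP[bp pt]]|nh x xX e _].
    have := nm x (sX xs) [` vE]%fset Logic.I; rewrite count_is0 /= /gap xs => N0.
    have [_ /(_ pt) hp] := n2 _ vE _ xs p (ptsE _ _ _ xp (ltW pt)).
    have [h1 [h2 [h3 h4]]] := bG _ vE.
    have : set0 p; last by [].
    rewrite -[X in X p]N0; split=> //=; rewrite in_itv /= (le_trans h1 bp) /=.
    rewrite -[ltRHS]/(edge_top (grid dl g) v); lra.
  rewrite count_is0 /= /gap; case: ifPn => xs; last by rewrite setI0.
  apply/seteqP; split => p //= [xp]; rewrite in_itv /= => /andP[bp pt].
  have [h1 [h2 [h3 h4]]] := bG _ (valP e).
  rewrite -/(edge_top (grid dl g) (val e)) in pt.
  have pt' : p < edge_top K (val e) by exact: lt_le_trans h3.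
  have [hp _] := n2 _ (valP e) _ xs p (ptsE _ _ _ xp (ltW pt')).
  apply: (nh (val e) x (valP e) xs); exists p => //; rewrite pt' andbT leNgt.
  by apply/negP => /[dup] /hp; lra.
split=> [[g _ [cg nm bU]]|[nh bU]]; first by split=> //; exact/(key g cg).
have idx (e : E) : exists j : 'I_(m.+1 ^ 2), (j : nat)%:R * dl < K (val e) <= (j : nat)%:R * dl + dl.
  apply: grid_index => //; rewrite natrX expr2 -mulrA mulfV ?mulr1 ?pnatr_eq0 //.
  exact: n1 (valP e).
(* By [idx] the default value of [xget] is never returned on E. *)
pose g : {ffun E -> 'I_(m.+1 ^ 2)} := [ffun e => xget (Ordinal (expn_gt0 m.+1 2 : (0 < m.+1 ^ 2)%N))
  [set j : 'I_(m.+1 ^ 2) | (j : nat)%:R * dl < K (val e) <= (j : nat)%:R * dl + dl]].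
have cg v : v \in E -> cell kappa dl g v w.
  move=> vE; have -> : v = val [` vE]%fset by [].
  rewrite /cell /= in_itv /= -[v]/(val [` vE]%fset) grid_val ffunE.
  by case: xgetP => [j _ //|/(_ _)] N; have [j hj] := idx [` vE]%fset; case: (N j).
by exists g => //; split=> //; exact/(key g cg).
Unshelve. all: by end_near. Qed.

(** Each one-edge sum tends to the Laplace transform of the exponential law at k/n, with k the
    number of processes to be avoided on that edge. *)
Lemma avoid_grid_prob : measurable avoid /\
  P avoid = ((\prod_(e : E) (2 / (2 + #|` s (val e)|%:R / n%:R))) * 2^-1 ^+ #|` U|)%:E.
Proof.
have [mA cA] := cvg_probability_eventually P measurable_slices slices_near.
split=> //; suff cB : P (slices m) @[m --> \oo] -->
    ((\prod_(e : E) (2 / (2 + #|` s (val e)|%:R / n%:R))) * 2^-1 ^+ #|` U|)%:E.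
  exact: (cvg_unique (@ereal_hausdorff R) cA cB).
under eq_cvg do rewrite slices_prob.
pose r (e : E) (m : nat) : R := \sum_(j < m.+1 ^ 2)
    ((expR (- (2 * (j%:R * m.+1%:R^-1))) - expR (- (2 * (j.+1%:R * m.+1%:R^-1))))
      * expR (- (#|` s (val e)|%:R / n%:R * (j%:R * m.+1%:R^-1)))).
have cr : \prod_(e : E) r e m @[m --> \oo] -->
    \prod_(e : E) (2 / (2 + #|` s (val e)|%:R / n%:R) : R).
  apply: (cvg_big (@mul_continuous R)) => e _.
  by apply: cvg_laplace_discretized; rewrite divr_ge0.
apply: cvg_EFin; first exact: nearW.
exact: (cvgM cr (cvg_cst _)).
Qed.

End Grid.
End Avoidance.

(** Injective only off the backbone: the backbone word of length i and the root of G(i+1) share the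
    address (i, [::]). *)
Definition address (u : word) : nat * word := (index true u, drop (index true u).+1 u).

Lemma address_inj u v : ~~ spine u -> ~~ spine v -> address u = address v -> u = v.
Proof.
by move=> /not_spineP uE /not_spineP vE [iE dE]; rewrite [LHS]uE [RHS]vE dE iE.
Qed.

(** * Independence through Dynkin systems *)

Section PiLambda.
Variables (R : realType) (d : measure_display) (Omega : measurableType d).
Variables (P : probability Omega R).

(** For fixed B, the measurable events independent of B form a Dynkin system. *)
Lemma indep_gen (G : set (set Omega)) (B : set Omega) :
  setI_closed G -> G `<=` measurable -> measurable B ->
  (forall A, G A -> P (A `&` B) = (P A * P B)%E) ->
  forall A, <<s G >> A -> measurable A /\ P (A `&` B) = (P A * P B)%E.
Proof.
move=> GI Gm mB GB A; rewrite -(setI_closed_g_dynkin_g_sigma_algebra GI).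
pose D := [set A | measurable A /\ P (A `&` B) = (P A * P B)%E].
suff dD : dynkin D by move=> /(_ D); apply; split=> // C GC; split; [exact: Gm|exact: GB].
split=> [|C [mC CB]|F tF FD].
- by split; rewrite ?setTI ?probability_setT ?mul1e.
- split; first exact: measurableC.
  have mCB : measurable (C `&` B) by exact: measurableI.
  have e : P B = (P (C `&` B) + P (~` C `&` B))%E.
    rewrite -measureU //; first by rewrite -setIUl setUv setTI.
      by apply: measurableI => //; exact: measurableC.
    by rewrite setIACA setICr set0I.
  have fin (A' : set Omega) : measurable A' -> exists r : R, P A' = r%:E.
    by move=> mA'; exists (fine (P A')); rewrite fineK // fin_num_measure.
  have [c cE] := fin _ mC; have [b bE] := fin _ mB; have [p pE] := fin _ mCB.
  have [q qE] : exists q : R, P (~` C `&` B) = q%:E.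
    by apply: fin; apply: measurableI => //; exact: measurableC.
  move: e CB; rewrite probability_setC // qE cE bE pE -EFinD -!EFinM.
  by move=> [e] [e']; congr (_%:E); rewrite mulrBl mul1r -e' e addrAC subrr add0r.
- have mF m : measurable (F m) by case: (FD m).
  split; first exact: bigcupT_measurable.
  rewrite setI_bigcupl measure_semi_bigcup //.
  + rewrite measure_semi_bigcup //; last exact: bigcupT_measurable.
    rewrite muleC -[P B]fineK ?fin_num_measure // -nneseriesZl; last first.
      by move=> m _; exact: measure_ge0.
    apply: eq_eseriesr => m _; rewrite fineK ?fin_num_measure // muleC.
    exact: (FD m).2.
  + by move=> m; exact: measurableI.
  + by apply: trivIset_setIr.
  + by apply: bigcupT_measurable => m; exact: measurableI.
Qed.

End PiLambda.

(** * Information carried by a set of vertices and edges *)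

Section Information.
Variables (R : realType) (d : measure_display) (Omega : measurableType d).
Variables (P : probability Omega R) (n : nat).
Variables (offspring : nat -> word -> {RV P >-> nat}) (kappa : word -> {RV P >-> R}).
Variable ppp : word -> Omega -> set R.
Hypothesis model : pruning_model n offspring kappa ppp.

Definition avoid_vertices (E : {fset word}) (s : word -> {fset word}) (U : {fset word}) :=
  [set w | (forall v x, v \in E -> x \in s v -> ~ hit_event kappa ppp x v w) /\
           (forall u, u \in U -> bit_event offspring (address u) w)].

Definition survival (k : nat) : R := 2 / (2 + k%:R / n%:R).

Lemma survival0 : survival 0 = 1.
Proof. by rewrite /survival mul0r addr0 divff // pnatr_eq0. Qed.

Lemma survival_lt1 : (1 <= n)%N -> survival 1 < 1.
Proof.
move=> n_gt0; have n0 : 0 < n%:R^-1 :> R by rewrite invr_gt0 ltr0n.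
by rewrite /survival ltr_pdivrMr ?mul1r //; lra.
Qed.

(** Closing E under prefixes adds edges on which no process has to be avoided; their factor is
    [survival 0], that is 1. *)
Lemma avoid_verticesP (E : {fset word}) (s : word -> {fset word}) (U : {fset word}) :
  (forall v x, x \in s v -> prefix v x) -> (forall u, u \in U -> ~~ spine u) ->
  measurable (avoid_vertices E s U) /\
  P (avoid_vertices E s U) =
    ((\prod_(v <- E) survival #|` s v|) * 2^-1 ^+ #|` U|)%:E.
Proof.
move=> s_prefix Uns.
pose E' := [fset u in flatten [seq [seq take i v | i <- iota 0 (size v).+1] | v <- E]]%fset.
have E'P u : reflect (exists2 v, v \in E & prefix u v) (u \in E').
  rewrite in_fset; apply: (iffP flatten_mapP) => [[v vE /mapP[i _ ->]]|[v vE uv]].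
    by exists v => //; exact: prefix_take.
  exists v => //; apply/mapP; exists (size u); last exact: prefix_takeE.
  by rewrite mem_iota ltnS size_prefix.
pose X := [fset u in flatten [seq enum_fset (s v) | v <- E]]%fset.
pose s' v := if v \in E then s v else fset0.
pose U' := [fset address u | u in U]%fset.
have E'_prefix u v : v \in E' -> prefix u v -> u \in E'.
  by move=> /E'P[x xE vx] uv; apply/E'P; exists x => //; exact: prefix_trans vx.
have s'X v x : x \in s' v -> x \in X.
  rewrite /s'; case: ifP => // vE xs.
  by rewrite in_fset; apply/flatten_mapP; exists v.
have s'_prefix v x : x \in s' v -> prefix v x.
  by rewrite /s'; case: ifP => // _; exact: s_prefix.
have -> : avoid_vertices E s U = avoid offspring kappa ppp E' s' U'.
  apply/seteqP; split=> w [hE hU]; split.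
  - by move=> v x _; rewrite /s'; case: ifP => // vE; exact: hE.
  - by move=> b /imfsetP[u /= uU ->]; exact: hU.
  - move=> v x vE xs; apply: hE; last by rewrite /s' vE.
    by apply/E'P; exists v => //; exact: prefix_refl.
  - by move=> u uU; apply: hU; exact: in_imfset.
have [mA ->] := avoid_grid_prob model U' E'_prefix s'X s'_prefix.
split=> //; congr ((_ * _ ^+ _)%:E); last first.
  rewrite card_in_imfset //= => u v uU vU; apply: address_inj; exact: Uns.
rewrite -(big_seq_fsetE _ E' xpredT (fun v => 2 / (2 + #|` s' v|%:R / n%:R))) /=.
have sub : (E `<=` E')%fset.
  by apply/fsubsetP => v vE; apply/E'P; exists v => //; exact: prefix_refl.
rewrite -(big_fset_incl _ sub) /=; last first.
  by move=> v _ vE; rewrite /s' (negbTE vE) cardfs0 -/(survival 0) survival0.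
by rewrite big_seq [RHS]big_seq; apply: eq_bigr => v vE; rewrite /s' vE.
Qed.

(** * Independence *)

(* [inl u] stands for the offspring number of u and [inr v] for the marks of
   all processes on the edge e_v. *)
Definition avoid_system (K : set (word + word)) : set (set Omega) :=
  [set A | exists E s U, [/\ forall v, v \in E -> K (inr v),
    forall u, u \in U -> K (inl u) /\ ~~ spine u,
    forall v x, x \in s v -> prefix v x & A = avoid_vertices E s U]].

Lemma measurable_avoid_system K : avoid_system K `<=` measurable.
Proof.
by move=> A [E [s [U [_ hU hs ->]]]]; have [] := @avoid_verticesP E s U hs (fun u h => (hU u h).2).
Qed.

(** The guards discard the values of s and s' outside E and E', which would otherwise add
    requirements. *)
Lemma avoid_vertices_setI E s U E' s' U' :
  avoid_vertices E s U `&` avoid_vertices E' s' U' =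
  avoid_vertices (E `|` E')%fset
    (fun v => ((if v \in E then s v else fset0) `|` (if v \in E' then s' v else fset0))%fset)
    (U `|` U')%fset.
Proof.
apply/seteqP; split => w.
  move=> [[hE hU] [hE' hU']]; split.
    move=> v x _; rewrite in_fsetU => /orP[]; case: ifP => // vE; first exact: hE.
    exact: hE'.
  by move=> u; rewrite in_fsetU => /orP[/hU|/hU'].
move=> [hE hU]; split; split.
- by move=> v x vE xs; apply: hE; rewrite !in_fsetU vE ?xs.
- by move=> u uU; apply: hU; rewrite in_fsetU uU.
- by move=> v x vE xs; apply: hE; rewrite !in_fsetU vE ?xs orbT.
- by move=> u uU; apply: hU; rewrite in_fsetU uU orbT.
Qed.

Lemma avoid_system_setI K : setI_closed (avoid_system K).
Proof.
move=> A B [E [s [U [hE hU hs ->]]]] [E' [s' [U' [hE' hU' hs' ->]]]].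
rewrite avoid_vertices_setI; do 3 eexists; split; last by [].
- by move=> v; rewrite in_fsetU => /orP[/hE|/hE'].
- by move=> u; rewrite in_fsetU => /orP[/hU|/hU'].
- by move=> v x; rewrite in_fsetU => /orP[]; case: ifP => // _; [exact: hs|exact: hs'].
Qed.

Lemma avoid_system_indep K K' A B : K `&` K' = set0 ->
  avoid_system K A -> avoid_system K' B -> P (A `&` B) = (P A * P B)%E.
Proof.
move=> KK' [E [s [U [hE hU hs ->]]]] [E' [s' [U' [hE' hU' hs' ->]]]].
have dis j : K j -> K' j -> False by move=> Kj Kj'; rewrite -[False]/(set0 j) -KK'.
have dE : [disjoint E & E']%fset.
  by apply/fdisjointP => v /hE Kv; apply/negP => /hE'; exact: dis.
have dU : [disjoint U & U']%fset.
  by apply/fdisjointP => u /hU[Ku _]; apply/negP => /hU'[Ku' _]; exact: dis Ku Ku'.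
rewrite avoid_vertices_setI.
rewrite (avoid_verticesP _ _ _).2; last 2 first.
- by move=> v x; rewrite in_fsetU => /orP[]; case: ifP => // _; [exact: hs|exact: hs'].
- by move=> u; rewrite in_fsetU => /orP[/hU[]|/hU'[]].
rewrite (avoid_verticesP E hs (fun u h => (hU u h).2)).2.
rewrite (avoid_verticesP E' hs' (fun u h => (hU' u h).2)).2.
rewrite -EFinM cardfsU (disjoint_fsetI0 dU) cardfs0 subn0 exprD mulrACA.
congr ((_ * _)%:E); rewrite (perm_big (enum_fset E ++ enum_fset E')) /=; last first.
  apply: uniq_perm; rewrite ?fset_uniq ?cat_uniq ?fset_uniq //=; last first.
    by move=> v; rewrite mem_cat in_fsetU.
  rewrite andbT; apply/hasPn => v vE; apply/negP => /hE Kv; exact: dis Kv (hE' _ vE).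
rewrite big_cat; congr (_ * _).
- rewrite big_seq [RHS]big_seq; apply: eq_bigr => v vE; rewrite vE.
  by have /fdisjointP/(_ v vE)/negbTE -> := dE; rewrite fsetU0.
- rewrite big_seq [RHS]big_seq; apply: eq_bigr => v vE; rewrite vE.
  by move: dE; rewrite fdisjoint_sym => /fdisjointP/(_ v vE)/negbTE ->; rewrite fset0U.
Qed.

(** Only the incidence of marks and edges is recorded, not the lengths nor the positions of the
    points. This makes distinct edges independent although their places depend on common lengths. *)
Definition info (K : set (word + word)) : set (set Omega) := <<s avoid_system K >>.

Lemma sigma_algebra_info K : sigma_algebra setT (info K).
Proof. exact: sigma_algebra_gen. Qed.

Lemma measurable_info K : info K `<=` measurable.
Proof.
apply: smallest_sub; first exact: sigma_algebra_measurable_set.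
exact: measurable_avoid_system.
Qed.

Lemma info_sub K K' : K `<=` K' -> info K `<=` info K'.
Proof.
move=> KK'; apply: sub_smallest2r; first exact: sigma_algebra_gen.
move=> A [E [s [U [hE hU hs ->]]]]; exists E, s, U; split=> //.
- by move=> v /hE/KK'.
- by move=> u /hU[/KK'].
Qed.

(** Dynkin's argument twice: first to reach every event of [info K'] against a generator of
    [info K], then to reach every event of [info K]. *)
Lemma info_indep K K' A B : K `&` K' = set0 -> info K A -> info K' B ->
  P (A `&` B) = (P A * P B)%E.
Proof.
move=> KK' iA iB.
have step A' : avoid_system K A' -> P (A' `&` B) = (P A' * P B)%E.
  move=> sA'; rewrite setIC muleC.
  apply: (indep_gen (@avoid_system_setI K') (@measurable_avoid_system K')
    (measurable_avoid_system sA') _ iB).2 => C sC.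
  by rewrite setIC muleC; exact: avoid_system_indep sA' sC.
exact: (indep_gen (@avoid_system_setI K) (@measurable_avoid_system K)
  (measurable_info iB) step iA).2.
Qed.

Lemma info_no_hit K v (s : seq word) : K (inr v) -> (forall x, x \in s -> prefix v x) ->
  info K [set w | forall x, x \in s -> ~ hit_event kappa ppp x v w].
Proof.
move=> Kv vs; apply: sub_gen_smallest.
exists [fset v]%fset, (fun u => if u == v then [fset x in s]%fset else fset0), fset0.
split.
- by move=> u /fset1P ->.
- by move=> u.
- by move=> u x; case: eqP => // ->; rewrite in_fset; exact: vs.
- apply/seteqP; split => w /=.
    by move=> h; split=> // u x /fset1P ->; rewrite eqxx in_fset; exact: h.
  by move=> [h _] x xs; apply: h; rewrite ?in_fset1 ?eqxx // in_fset.
Qed.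

Lemma no_hit_prob v (s : seq word) : (forall x, x \in s -> prefix v x) -> uniq s ->
  P [set w | forall x, x \in s -> ~ hit_event kappa ppp x v w] = (survival (size s))%:E.
Proof.
move=> vs us; pose s' u := if u == v then [fset x in s]%fset else fset0.
have -> : [set w | forall x, x \in s -> ~ hit_event kappa ppp x v w] =
    avoid_vertices [fset v]%fset s' fset0.
  apply/seteqP; split => w /=.
    by move=> h; split=> // u x /fset1P ->; rewrite /s' eqxx in_fset; exact: h.
  by move=> [h _] x xs; apply: (h v); rewrite ?in_fset1 ?eqxx // /s' eqxx in_fset.
rewrite (avoid_verticesP _ _ _).2 //; last first.
  by move=> u x; rewrite /s'; case: eqP => // ->; rewrite in_fset; exact: vs.
by rewrite cardfs0 expr0 mulr1 big_seq_fset1 /s' eqxx card_fseq undup_id.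
Qed.

Lemma info_hit K v x : K (inr v) -> prefix v x -> info K (hit_event kappa ppp x v).
Proof.
move=> Kv vx; rewrite -[X in info K X]setCK.
apply: (sigma_setC (sigma_algebra_info K)).
have -> : ~` hit_event kappa ppp x v =
    [set w | forall y, y \in [:: x] -> ~ hit_event kappa ppp y v w].
  apply/seteqP; split => w /=; first by move=> h y; rewrite inE => /eqP ->.
  by apply; rewrite inE.
by apply: info_no_hit => // y; rewrite inE => /eqP ->.
Qed.

Definition branch_event (u : word) : set Omega :=
  [set w | branches (fun i v => offspring i v w) u].

Lemma branch_eventE u : branch_event u =
  if spine u then setT else bit_event offspring (address u).
Proof.
apply/seteqP; rewrite /branch_event /branches; case: ifP => us; split => w //=.
  by move=> /eqP.
by move=> /= ->.
Qed.

Lemma info_branch K u : K (inl u) -> info K (branch_event u).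
Proof.
move=> Ku; rewrite branch_eventE; case: ifPn => us.
  exact: (sigma_setT (sigma_algebra_info K)).
apply: sub_gen_smallest; exists fset0, (fun=> fset0), [fset u]%fset; split=> //.
- by move=> v /fset1P ->.
- apply/seteqP; split => w /=; first by move=> h; split=> // v /fset1P ->.
  by move=> [_]; apply; rewrite in_fset1.
Qed.

Lemma branch_prob u : P (branch_event u) = (if spine u then 1 else 2^-1)%:E.
Proof.
rewrite branch_eventE; case: ifPn => us; first exact: probability_setT.
exact: (bit_event_prob model).
Qed.

End Information.

(** * The law of the number of internal nodes *)

Section Mixture.
Variables (R : realType) (d : measure_display) (Omega : measurableType d).
Variable P : probability Omega R.

(** Conditioning on which of the disjoint F_i occurs: the conditional probability of G_i is r
    whatever i. *)
Lemma probability_mixture (I : countType) (D : set I) (F G : I -> set Omega) (r : R) :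
  0 <= r ->
  (forall i, D i -> measurable (F i)) -> (forall i, D i -> measurable (G i)) ->
  trivIset D F -> (forall i, D i -> P (F i `&` G i) = (r%:E * P (F i))%E) ->
  P (\bigcup_(i in D) (F i `&` G i)) = (r%:E * P (\bigcup_(i in D) F i))%E.
Proof.
move=> r0 mF mG tF FG.
(* The test on m retains a single index for each i, so that the family over nat stays disjoint. *)
pose sel (H : I -> set Omega) (m : nat) :=
  if @choice.unpickle I m is Some i then
    if `[< D i >] && (m == choice.pickle i) then H i else set0 else set0.
have selE H : \bigcup_(i in D) H i = \bigcup_m sel H m.
  apply/seteqP; split => [w [i Di Hi]|w [m _]].
    by exists (choice.pickle i) => //; rewrite /sel choice.pickleK asboolT //= eqxx.
  rewrite /sel; case: choice.unpickle => // i; case: asboolP => //= Di.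
  by case: eqP => // _ Hi; exists i.
have msel H : (forall i, D i -> measurable (H i)) -> forall m, measurable (sel H m).
  move=> mH m; rewrite /sel; case: choice.unpickle => // i.
  by case: asboolP => //= Di; case: eqP => // _; exact: mH.
have tsel H : trivIset D H -> trivIset setT (sel H).
  move=> /trivIsetP tH; apply/trivIsetP => m m' _ _ mm'; rewrite /sel.
  case: choice.unpickle => [i|]; last by rewrite set0I.
  case: asboolP => /= Di; last by rewrite set0I.
  case: eqP => [mi|_]; last by rewrite set0I.
  case: choice.unpickle => [j|]; last by rewrite setI0.
  case: asboolP => /= Dj; last by rewrite setI0.
  case: eqP => [mj|_]; last by rewrite setI0.
  by apply: tH => //; apply: contra_neq mm' => ij; rewrite mi mj ij.
have mFG i : D i -> measurable (F i `&` G i).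
  by move=> Di; apply: measurableI; [exact: mF|exact: mG].
have tFG : trivIset D (fun i => F i `&` G i).
  apply/trivIsetP => i j Di Dj ij; rewrite setIACA.
  by move/trivIsetP: tF => ->; rewrite ?set0I.
rewrite !selE measure_semi_bigcup; last 3 first.
- exact: msel.
- exact: tsel.
- by apply: bigcupT_measurable; exact: msel.
rewrite measure_semi_bigcup; last 3 first.
- exact: msel.
- exact: tsel.
- by apply: bigcupT_measurable; exact: msel.
rewrite -nneseriesZl; last by move=> m _; exact: measure_ge0.
apply: eq_eseriesr => m _; rewrite /sel.
case: choice.unpickle => [i|]; last by rewrite !measure0 mule0.
case: asboolP => /= Di; last by rewrite !measure0 mule0.
by case: eqP => _; [exact: FG|rewrite !measure0 mule0].
Qed.

End Mixture.

(** * Measurability of the recursion from the leaves *)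

Section ActMeasurability.
Variables (R : realType) (d : measure_display) (Omega : measurableType d).
Variables (P : probability Omega R) (n : nat).
Variables (offspring : nat -> word -> {RV P >-> nat}) (kappa : word -> {RV P >-> R}).
Variable ppp : word -> Omega -> set R.
Hypothesis model : pruning_model n offspring kappa ppp.

Local Notation hit_event := (hit_event kappa ppp).
Local Notation branch_event := (branch_event offspring).
Local Notation info := (info offspring kappa ppp).
Local Notation survival := (survival R n).

Definition hits (w : Omega) (x v : word) : bool := `[< hit_event x v w >].

Definition act_event (sp : Omega -> word -> bool) h v (s : seq word) : set Omega :=
  [set w | act (sp w) (hits w) h v = Some s].

(** The pairs of lists are restricted to nodes above v because [sigma_act] controls [hit_event x v]
    only for these. *)
Lemma act_eventS sp h v s : act_event sp h.+1 v s =
  ([set w | ~~ sp w v] `&` [set w | s = [::]]) `|`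
  \bigcup_(ab in [set ab : seq word * seq word | all (prefix v) (ab.1 ++ ab.2)])
    ([set w | sp w v] `&` act_event sp h (rcons v false) ab.1
      `&` act_event sp h (rcons v true) ab.2 `&`
     (([set w | forall x, x \in v :: ab.1 ++ ab.2 -> ~ hit_event x v w] `&`
        [set w | s = v :: ab.1 ++ ab.2]) `|`
      (~` [set w | forall x, x \in v :: ab.1 ++ ab.2 -> ~ hit_event x v w] `&`
        [set w | s = [::]]))).
Proof.
have crossE w L : cross (hits w) v L = s <->
    (([set w | forall x, x \in L -> ~ hit_event x v w] `&` [set w | s = L]) `|`
     (~` [set w | forall x, x \in L -> ~ hit_event x v w] `&` [set w | s = [::]])) w.
  rewrite /cross; case: ifPn => [/hasP[x xL /asboolP xv]|/hasPn N]; split.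
  - by move=> <-; right; split=> //= /(_ x xL).
  - by move=> [[/= /(_ x xL)]//|[_ /= ->]].
  - by move=> <-; left; split=> //= x /N /asboolPn.
  - move=> [[_ /= ->]//|[/= H _]]; exfalso; apply: H => x /N /asboolPn; exact.
apply/seteqP; split => w; rewrite /act_event /=.
  case E: (sp w v); last by move=> [<-]; left.
  case E0: (act _ _ h _) => [a|//]; case E1: (act _ _ h (rcons v true)) => [b|//] [e].
  right; exists (a, b) => /=; last by split; [|exact/crossE].
  have /andP[_ /allP ha] := act_uniq E0; have /andP[_ /allP hb] := act_uniq E1.
  apply/allP => x; rewrite mem_cat => /orP[/ha|/hb] /prefix_rconsW /andP[] //.
move=> [[/negbTE -> ->]//|[[a b] /= _ [[[-> ->] ->] H]]].
by congr Some; apply/crossE.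
Qed.

(** General in S and sp: it serves [spine_split] with the information above v, and
    [truncation_split] with all measurable events. *)
Lemma sigma_act (S : set (set Omega)) (sp : Omega -> word -> bool) h v s : sigma_algebra setT S ->
  (forall u, prefix v u -> S [set w | sp w u]) ->
  (forall u x, prefix v u -> prefix u x -> S (hit_event x u)) ->
  S (act_event sp h v s).
Proof.
move=> sS.
have Sprop (Q : Prop) : S [set w | Q].
  have [q|q] := pselect Q.
    by rewrite (_ : [set w | Q] = setT); [exact: sigma_setT|apply/seteqP; split].
  by rewrite (_ : [set w | Q] = set0); [exact: sigma_set0|apply/seteqP; split].
elim: h v s => [|h IH] v s Ssp Shit.
  have -> : act_event sp 0 v s = ~` [set w | sp w v] `&` [set w | s = [::]].
    apply/seteqP; split => w; rewrite /act_event /=; case: (sp w v) => //=.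
    - by move=> [<-].
    - by case.
    - by move=> [_ ->].
  apply: sigma_setI => //; apply: sigma_setC => //; apply: Ssp.
  exact: prefix_refl.
have Sv := Ssp v (prefix_refl v).
have IHb b t : S (act_event sp h (rcons v b) t).
  apply: IH => [u vu|u x vu]; [apply: Ssp|apply: Shit];
    exact: prefix_trans (prefix_rcons _ _) vu.
rewrite act_eventS; apply: sigma_setU => //.
  apply: sigma_setI => //; rewrite (_ : [set w | ~~ sp w v] = ~` [set w | sp w v]).
    exact: sigma_setC.
  by apply/seteqP; split => w /negP.
apply: sigma_bigcup => // -[a b] /= /allP ab.
have SN : S [set w | forall x, x \in v :: a ++ b -> ~ hit_event x v w].
  have -> : [set w | forall x, x \in v :: a ++ b -> ~ hit_event x v w] =
      \bigcap_(x in [set` v :: a ++ b]) ~` hit_event x v.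
    by apply/seteqP; split => w /= h' x; exact: h'.
  apply: sigma_bigcap => // x xL; apply: sigma_setC => //; apply: Shit.
    exact: prefix_refl.
  by move: xL; rewrite /= inE => /orP[/eqP ->|/ab//]; exact: prefix_refl.
apply: sigma_setI => //; first by apply: sigma_setI => //; exact: sigma_setI.
by apply: sigma_setU => //; apply: sigma_setI => //; exact: sigma_setC.
Qed.

End ActMeasurability.

Definition above (v : word) : set (word + word) :=
  [set j | match j with inl u => prefix v u | inr u => prefix v u end].

Section SizeLaw.
Variables (R : realType) (d : measure_display) (Omega : measurableType d).
Variables (P : probability Omega R) (n : nat).
Variables (offspring : nat -> word -> {RV P >-> nat}) (kappa : word -> {RV P >-> R}).
Variable ppp : word -> Omega -> set R.
Hypothesis model : pruning_model n offspring kappa ppp.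

Local Notation hit_event := (hit_event kappa ppp).
Local Notation branch_event := (branch_event offspring).
Local Notation info := (info offspring kappa ppp).
Local Notation survival := (survival R n).
Local Notation hits := (hits kappa ppp).

(* On the backbone, marking one's own edge amounts to having no children. *)
Definition spine_split (w : Omega) (v : word) : bool :=
  branches (fun i u => offspring i u w) v && ~~ (spine v && hits w v v).

Definition split_event v : set Omega := [set w | spine_split w v].

Local Notation act_event := (act_event kappa ppp spine_split).

Definition law_event h v k : set Omega :=
  \bigcup_(s in [set s : seq word | size s = k]) act_event h v s.

Definition total_event h v : set Omega := \bigcup_s act_event h v s.

Lemma survival_ge0 k : 0 <= survival k.
Proof. by rewrite /survival divr_ge0 // addr_ge0 // divr_ge0. Qed.

Lemma info_split K v : K (inl v) -> K (inr v) -> info K (split_event v).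
Proof.
move=> Kl Kr.
have -> : split_event v = branch_event v `&` ~` (if spine v then hit_event v v else set0).
  apply/seteqP; split => w; rewrite /split_event /spine_split /branch_event /=.
    by move=> /andP[-> h]; split=> // hv; move: h; case: (spine v) hv => //= hv; rewrite /hits asboolT.
  move=> [-> h]; case: (spine v) h => //= h; exact/asboolPn.
apply: (sigma_setI (sigma_algebra_info _ _ _ _)); first exact: info_branch.
apply: (sigma_setC (sigma_algebra_info _ _ _ _)); case: ifP => _.
  by apply: info_hit => //; exact: prefix_refl.
exact: (sigma_set0 (sigma_algebra_info _ _ _ _)).
Qed.

Lemma split_prob v :
  P (split_event v) = (if spine v then survival 1 else 2^-1)%:E.
Proof.
case: ifPn => sv; last first.
  have -> : split_event v = branch_event v.
    by apply/seteqP; split => w; rewrite /split_event /spine_split /= (negbTE sv) /= andbT.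
  by rewrite (branch_prob model) (negbTE sv).
have -> : split_event v = [set w | forall x, x \in [:: v] -> ~ hit_event x v w].
  apply/seteqP; split => w; rewrite /split_event /spine_split /= sv /branches sv /=.
    by move=> /asboolPn h x; rewrite inE => /eqP ->.
  by move=> h; apply/asboolPn; apply: h; rewrite inE.
rewrite (no_hit_prob model) // => x; rewrite inE => /eqP ->; exact: prefix_refl.
Qed.

Lemma info_act h v s : info (above v) (act_event h v s).
Proof.
apply: sigma_act; first exact: sigma_algebra_info.
  by move=> u vu; apply: info_split.
by move=> u x vu ux; apply: info_hit.
Qed.

Lemma info_law h v k : info (above v) (law_event h v k).
Proof.
by apply: (sigma_bigcup (sigma_algebra_info _ _ _ _)) => s _; exact: info_act.
Qed.

Lemma info_total h v : info (above v) (total_event h v).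
Proof.
by apply: (sigma_bigcup (sigma_algebra_info _ _ _ _)) => s _; exact: info_act.
Qed.

Lemma measurable_law h v k : measurable (law_event h v k).
Proof. by apply: (measurable_info model); exact: info_law. Qed.

Lemma measurable_total h v : measurable (total_event h v).
Proof. by apply: (measurable_info model); exact: info_total. Qed.

Lemma measurable_split v : measurable (split_event v).
Proof. by apply: (measurable_info model (K := setT)); exact: info_split. Qed.

Lemma above_disj v : above (rcons v false) `&` above (rcons v true) = set0.
Proof.
by apply/seteqP; split => -[u|u] //= [h0 h1]; exact: prefix_rcons_disj h0 h1.
Qed.

Lemma not_prefix_rcons (v : word) b : prefix (rcons v b) v = false.
Proof. by apply/negbTE/negP => /prefix_rconsW; rewrite strict_prefixE ltnn andbF. Qed.

Definition children (v : word) := above (rcons v false) `|` above (rcons v true).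

Lemma children_disj v (j : word + word) : j = inl v \/ j = inr v ->
  children v `&` [set j] = set0.
Proof.
by case=> ->; apply/seteqP; split => i //= [h e]; move: h; rewrite e => -[];
  rewrite /above /= not_prefix_rcons.
Qed.

Lemma info_children_l v A : info (above (rcons v false)) A -> info (children v) A.
Proof. by apply: info_sub => j; left. Qed.

Lemma info_children_r v A : info (above (rcons v true)) A -> info (children v) A.
Proof. by apply: info_sub => j; right. Qed.

(** A nonzero size means that e_v is not cut, so all of v :: a ++ b miss it, where a and b are the
    lists of the children. These are k + 1 distinct processes, whose marks on e_v are independent of
    the lists. *)
Lemma law_rec h v k : P (law_event h.+1 v k.+1) =
  ((if spine v then 1 else 2^-1)%:E * (survival k.+1)%:E *
   \sum_(i < k.+1) P (law_event h (rcons v false) i) * P (law_event h (rcons v true) (k - i)))%E.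
Proof.
(* F uses [branch_event], not [split_event]: on the backbone, the absence of a mark of v on e_v
   already belongs to G, and F must not depend on the marks on e_v. *)
pose F (ab : seq word * seq word) := branch_event v `&`
  (act_event h (rcons v false) ab.1 `&` act_event h (rcons v true) ab.2).
pose G (ab : seq word * seq word) :=
  [set w | forall x, x \in v :: ab.1 ++ ab.2 -> ~ hit_event x v w].
pose D := [set ab : seq word * seq word |
  (size ab.1 + size ab.2 = k)%N /\ all (prefix v) (ab.1 ++ ab.2)].
have actP (w : Omega) a b : act (spine_split w) (hits w) h (rcons v false) = Some a ->
    act (spine_split w) (hits w) h (rcons v true) = Some b ->
    uniq (v :: a ++ b) /\ all (prefix v) (a ++ b).
  move=> E0 E1; have /andP[uL pL] := children_uniq (act_uniq E0) (act_uniq E1).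
  by split=> //; case/andP: pL.
have -> : law_event h.+1 v k.+1 = \bigcup_(ab in D) (F ab `&` G ab).
  apply/seteqP; split => w.
    move=> [s /= sk]; rewrite /act_event /=.
    case E: (spine_split w v); last by move=> [se]; rewrite -se in sk.
    case E0: (act _ _ h _) => [a|//]; case E1: (act _ _ h (rcons v true)) => [b|//] [e].
    have [_ pab] := actP _ _ _ E0 E1.
    move: e; rewrite /cross; case: ifPn => [_ se|/hasPn N se]; first by rewrite -se in sk.
    exists (a, b); first by split=> //; move: sk; rewrite -se /= size_cat => -[].
    split; first by split=> //; move: E => /andP[].
    by move=> x /N /asboolPn.
  move=> [[a b] [/= sab pab] [[Bv [E0 E1]] N]]; exists (v :: a ++ b); first by rewrite /= size_cat sab.
  rewrite /act_event /=; have -> : spine_split w v.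
    rewrite /spine_split; apply/andP; split=> //; rewrite negb_and; apply/orP; right.
    by apply/asboolPn; apply: N; rewrite mem_head.
  rewrite (E0 : act _ _ _ _ = _) (E1 : act _ _ _ _ = _) /cross ifN //.
  by apply/hasPn => x /N /asboolPn.
have iF ab : info ([set inl v] `|` children v) (F ab).
  apply: (sigma_setI (sigma_algebra_info _ _ _ _)).
    by apply: info_branch; left.
  apply: (info_sub (K := children v)); first by move=> j; right.
  apply: (sigma_setI (sigma_algebra_info _ _ _ _)).
    by apply: info_children_l; exact: info_act.
  by apply: info_children_r; exact: info_act.
have iG ab : D ab -> info [set inr v] (G ab).
  move=> [_ /allP pab]; apply: info_no_hit => // x.
  by rewrite inE => /orP[/eqP ->|/pab //]; exact: prefix_refl.
have tF : trivIset D F.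
  apply/trivIsetP => -[a b] [a' b'] _ _ ne; apply/seteqP; split => w //=.
  move=> [[_ [E0 E1]] [_ [E0' E1']]]; move/eqP: ne; apply; congr pair.
    by move: E0; rewrite /act_event /= (E0' : act _ _ _ _ = _) => -[].
  by move: E1; rewrite /act_event /= (E1' : act _ _ _ _ = _) => -[].
rewrite (probability_mixture (survival_ge0 k.+1)) //; last 3 first.
- by move=> ab _; apply: (measurable_info model); exact: iF.
- by move=> ab /iG h'; apply: (measurable_info model); exact: h'.
(* A nonempty F provides a sample point where [act] computes the two lists, which proves that v :: a
   ++ b has no repetition. *)
- move=> ab Dab; have [-> |/set0P[w [_ [E0 E1]]]] := eqVneq (F ab) set0.
    by rewrite set0I measure0 mule0.
  rewrite (info_indep model _ (iF ab) (iG _ Dab)); last first.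
    apply/seteqP; split => j //= [+ e]; rewrite {}e => -[//|] H.
    have : (children v `&` [set inr v]) (inr v) by [].
    by rewrite children_disj //; right.
  have [uL pab] := actP _ _ _ E0 E1.
  rewrite (no_hit_prob model) //; last first.
    by move=> x; rewrite inE => /orP[/eqP ->|]; [exact: prefix_refl|move/allP: pab; apply].
  by rewrite /= size_cat Dab.1 muleC.
rewrite [((_)%:E * (survival k.+1)%:E)%E]muleC -muleA; congr (_ * _)%E.
have -> : \bigcup_(ab in D) F ab = branch_event v `&`
    \big[setU/set0]_(i < k.+1) (law_event h (rcons v false) i `&` law_event h (rcons v true) (k - i)).
  rewrite -(bigcup_mkord _ (fun i => law_event h (rcons v false) i `&` law_event h (rcons v true) (k - i))).
  apply/seteqP; split => w.
    move=> [[a b] [/= sab _] [Bv [E0 E1]]]; split=> //; exists (size a) => /=; first by lia.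
    by split; [exists a|exists b => //=; lia].
  move=> [Bv [i /= ik [[a /= sa E0] [b /= sb E1]]]]; exists (a, b) => //.
  by split; [move=> /=; lia|exact: (actP _ _ _ E0 E1).2].
rewrite (info_indep model (K := [set inl v]) (K' := children v)); last 3 first.
- by rewrite setIC; apply: children_disj; left.
- exact: info_branch.
- rewrite -(bigcup_mkord _ (fun i => law_event h (rcons v false) i `&` law_event h (rcons v true) (k - i))).
  apply: (sigma_bigcup (sigma_algebra_info _ _ _ _)) => i _.
  apply: (sigma_setI (sigma_algebra_info _ _ _ _)).
    by apply: info_children_l; exact: info_law.
  by apply: info_children_r; exact: info_law.
rewrite (branch_prob model); congr (_ * _)%E.
rewrite (measure_bigsetU_ord P xpredT (F := fun i : 'I_k.+1 => law_event h (rcons v false) i `&` law_event h (rcons v true) (k - i)));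
  last 2 first.
- by move=> i; apply: measurableI; exact: measurable_law.
- apply/trivIsetP => i j _ _ ij; apply/seteqP; split => w //=.
  move=> [[[a /= sa E0] _] [[a' /= sa' E0'] _]]; move/eqP: ij; apply; apply/val_inj.
  rewrite /= -sa -sa'; congr size.
  by move: E0; rewrite /act_event /= (E0' : act _ _ _ _ = _) => -[].
apply: eq_bigr => i _; apply: (info_indep model); first exact: above_disj.
- exact: info_law.
- exact: info_law.
Qed.

(** Crossing e_v does not affect whether the recursion ends: either v does not split, or both
    children succeed. *)
Lemma total_rec h v : P (total_event h.+1 v) =
  (1 - P (split_event v) +
   P (split_event v) * (P (total_event h (rcons v false)) * P (total_event h (rcons v true))))%E.
Proof.
pose T := total_event h (rcons v false) `&` total_event h (rcons v true).
have -> : total_event h.+1 v = ~` split_event v `|` (split_event v `&` T).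
  apply/seteqP; split => w.
    move=> [s _]; rewrite /act_event /= /split_event /=.
    case E: (spine_split w v); last by left.
    case E0: (act _ _ h _) => [a|//]; case E1: (act _ _ h (rcons v true)) => [b|//] _.
    by right; split=> //; split; [exists a|exists b].
  move=> [/= Sv|[Sv [[a _ E0] [b _ E1]]]].
    by exists [::] => //; rewrite /act_event /=; move/negP/negbTE: Sv => ->.
  exists (cross (hits w) v (v :: a ++ b)) => //; rewrite /act_event /= (Sv : spine_split w v = true).
  by rewrite (E0 : act _ _ _ _ = _) (E1 : act _ _ _ _ = _).
have iT : info (children v) T.
  apply: (sigma_setI (sigma_algebra_info _ _ _ _)).
    by apply: info_children_l; exact: info_total.
  by apply: info_children_r; exact: info_total.
have mT := measurable_info model iT.
have -> : P (~` split_event v `|` (split_event v `&` T)) =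
    (P (~` split_event v) + P (split_event v `&` T))%E.
  apply: measureU.
  - by apply: measurableC; exact: measurable_split.
  - by apply: measurableI => //; exact: measurable_split.
  - by rewrite setIA setICl set0I.
rewrite probability_setC; last exact: measurable_split.
congr (_ + _)%E; rewrite (info_indep model (K := [set inl v; inr v]) (K' := children v)) //.
- congr (_ * _)%E; apply: (info_indep model (above_disj v)); exact: info_total.
- apply/seteqP; split => j //= [[->|->] H].
    have : (children v `&` [set inl v]) (inl v) by [].
    by rewrite children_disj //; left.
  have : (children v `&` [set inr v]) (inr v) by [].
  by rewrite children_disj //; right.
- by apply: info_split; [left|right].
Qed.

Lemma law_event0 v k : law_event 0 v k = if k is 0%N then ~` split_event v else set0.
Proof.
case: k => [|k]; apply/seteqP; split => w //=.
- by move=> [s _]; rewrite /act_event /= /split_event /=; case: (spine_split w v).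
- move=> /negP Sv; exists [::] => //; rewrite /act_event /=.
  by move: Sv => /negbTE ->.
- by move=> [s /= sk]; rewrite /act_event /=; case: (spine_split w v) => // -[se]; rewrite -se in sk.
Qed.

Lemma total_event_law h v : total_event h v = \bigcup_k law_event h v k.
Proof.
apply/seteqP; split => w; first by move=> [s _ Es]; exists (size s) => //; exists s.
by move=> [k _ [s _ Es]]; exists s.
Qed.

Lemma trivIset_law h v : trivIset setT (law_event h v).
Proof.
apply/trivIsetP => k k' _ _ /eqP kk'; apply/seteqP; split => w //=.
move=> [[s /= sk Es] [s' /= sk' Es']]; apply: kk'; rewrite -sk -sk'; congr size.
by move: Es; rewrite /act_event /= (Es' : act _ _ _ _ = _) => -[].
Qed.

Lemma total_event0 v : total_event 0 v = ~` split_event v.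
Proof.
rewrite total_event_law; apply/seteqP; split => w.
  by move=> [k _]; rewrite law_event0; case: k.
by move=> Sv; exists 0%N => //; rewrite law_event0.
Qed.

Lemma total_sum h v : P (total_event h v) = (\sum_(0 <= k <oo) P (law_event h v k))%E.
Proof.
rewrite total_event_law measure_semi_bigcup //.
- exact: measurable_law.
- exact: trivIset_law.
- by apply: bigcupT_measurable => k; exact: measurable_law.
Qed.

Lemma total_spine h v v' : spine v = spine v' ->
  P (total_event h v) = P (total_event h v').
Proof.
elim: h v v' => [|h IH] v v' e.
  rewrite !total_event0 !probability_setC; try exact: measurable_split.
  by rewrite !split_prob e.
rewrite !total_rec !split_prob e.
by rewrite (IH (rcons v false) (rcons v' false)) ?(IH (rcons v true) (rcons v' true)) //;
  rewrite !spine_rcons e.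
Qed.

(** [law_rec] covers nonzero sizes only; the probability of size 0 is recovered by subtracting the
    others from the total mass. *)
Lemma law_spine h v v' k : spine v = spine v' ->
  P (law_event h v k) = P (law_event h v' k).
Proof.
elim: h v v' k => [|h IH] v v' k e.
  rewrite !law_event0; case: k => [|k]; last by rewrite !measure0.
  rewrite !probability_setC; try exact: measurable_split.
  by rewrite !split_prob e.
have S k' : P (law_event h.+1 v k'.+1) = P (law_event h.+1 v' k'.+1).
  rewrite !law_rec e; congr (_ * _)%E; apply: eq_bigr => i _.
  by rewrite (IH (rcons v false) (rcons v' false)) ?(IH (rcons v true) (rcons v' true)) //;
    rewrite !spine_rcons e.
case: k => [|k]; last exact: S.
have := total_spine h.+1 e; rewrite !total_sum.
have ge0 u j : (0 <= P (law_event h.+1 u j))%E by exact: measure_ge0.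
have split1 u : (\sum_(0 <= j <oo) P (law_event h.+1 u j) =
    P (law_event h.+1 u 0) + \sum_(0 <= j <oo) (if j is j'.+1 then P (law_event h.+1 u j) else 0))%E.
  rewrite (nneseries_split 0 1) // big_nat1; congr (_ + _)%E.
  rewrite [RHS](nneseries_split 0 1); last by case.
  rewrite big_nat1 add0e !(@eseries_cond _ _ _ 1).
  by apply: eq_eseriesr => -[].
rewrite !split1; set t := (X in (_ + X = _ -> _)%E); set t' := (X in (_ = _ + X -> _)%E).
have -> : t' = t by apply: eq_eseriesr => -[|j] _ //; rewrite S.
have tfin : t \is a fin_num.
  rewrite ge0_fin_numE; last by apply: nneseries_ge0 => -[|j] _ _.
  apply: le_lt_trans (ltry 1); apply: le_trans (probability_le1 P (measurable_total h.+1 v)).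
  by rewrite total_sum split1 leeDr.
by move=> /(congr1 (fun z => z - t)%E); rewrite !addeK.
Qed.

End SizeLaw.

(** * Removing the bound on the height *)

Section SizeLawLimit.
Variables (R : realType) (d : measure_display) (Omega : measurableType d).
Variables (P : probability Omega R) (n : nat).
Variables (offspring : nat -> word -> {RV P >-> nat}) (kappa : word -> {RV P >-> R}).
Variable ppp : word -> Omega -> set R.
Hypothesis n_gt0 : (1 <= n)%N.
Hypothesis model : pruning_model n offspring kappa ppp.

Local Notation survival := (survival R n).
Local Notation law_event := (law_event offspring kappa ppp).
Local Notation total_event := (total_event offspring kappa ppp).
Local Notation split_event := (split_event offspring kappa ppp).

Definition size_event v k : set Omega := \bigcup_h law_event h v k.
Definition finite_event v : set Omega := \bigcup_h total_event h v.
Definition size_law v k : R := fine (P (size_event v k)).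

Lemma measurable_size v k : measurable (size_event v k).
Proof. by apply: bigcupT_measurable => h; exact: (measurable_law model). Qed.

Lemma measurable_finite v : measurable (finite_event v).
Proof. by apply: bigcupT_measurable => h; exact: (measurable_total model). Qed.

Lemma size_event_prob v k : P (size_event v k) = (size_law v k)%:E.
Proof. by rewrite fineK // fin_num_measure //; exact: measurable_size. Qed.

Lemma cvg_law v k : fine (P (law_event h v k)) @[h --> \oo] --> size_law v k.
Proof.
apply: fine_cvg; rewrite -size_event_prob.
apply: (nondecreasing_cvg_mu (F := fun h => law_event h v k)).
- by move=> h; exact: (measurable_law model).
- exact: measurable_size.
- move=> h h' hh'; apply/subsetPset => w [s sk Es]; exists s => //.
  exact: act_mono hh' Es.
Qed.

Lemma cvg_total v : fine (P (total_event h v)) @[h --> \oo] --> fine (P (finite_event v)).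
Proof.
apply: fine_cvg; rewrite fineK ?fin_num_measure //; last exact: measurable_finite.
apply: (nondecreasing_cvg_mu (F := fun h => total_event h v)).
- by move=> h; exact: (measurable_total model).
- exact: measurable_finite.
- move=> h h' hh'; apply/subsetPset => w [s sk Es]; exists s => //.
  exact: act_mono hh' Es.
Qed.

Lemma cvg_eq_unique (u u' : nat -> R) (l l' : R) :
  u @ \oo --> l -> u' @ \oo --> l' -> u =1 u' -> l = l'.
Proof.
move=> ul u'l' /funext uu'; rewrite -uu' in u'l'.
exact: (cvg_unique (@Rhausdorff R) ul u'l').
Qed.

Lemma cvg_shift_unique (u u' : nat -> R) (l l' : R) :
  u @ \oo --> l -> u' @ \oo --> l' -> (forall h, u h.+1 = u' h) -> l = l'.
Proof.
move=> ul u'l' uu'; apply: (cvg_eq_unique (u := fun h => u h.+1) _ u'l') => //.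
by rewrite (cvg_shiftS u).
Qed.

Lemma size_law_spine v v' k : spine v = spine v' -> size_law v k = size_law v' k.
Proof.
move=> e; apply: (cvg_eq_unique (@cvg_law v k) (@cvg_law v' k)) => h.
by rewrite (law_spine model _ _ e).
Qed.

Lemma finite_event_spine v v' : spine v = spine v' ->
  fine (P (finite_event v)) = fine (P (finite_event v')).
Proof.
move=> e; apply: (cvg_eq_unique (@cvg_total v) (@cvg_total v')) => h.
by rewrite (total_spine model _ e).
Qed.

Lemma size_law_rec v k : size_law v k.+1 =
  (if spine v then 1 else 2^-1) * survival k.+1 *
  \sum_(i < k.+1) size_law (rcons v false) i * size_law (rcons v true) (k - i).
Proof.
pose r (i : 'I_k.+1) h := fine (P (law_event h (rcons v false) i)) *
    fine (P (law_event h (rcons v true) (k - i))).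
apply: (cvg_shift_unique (@cvg_law v k.+1)
  (u' := fun h => (if spine v then 1 else 2^-1) * survival k.+1 * \sum_i r i h)); last first.
  move=> h; rewrite (law_rec model) -!EFinM.
  under eq_bigr => i _.
    rewrite -(fineK (fin_num_measure P _ (measurable_law model h (rcons v false) i))).
    rewrite -(fineK (fin_num_measure P _ (measurable_law model h (rcons v true) (k - i)))).
    over.
  by under eq_bigr do rewrite -EFinM; rewrite sumEFin.
apply: cvgM; first exact: cvg_cst.
apply: (cvg_big (@add_continuous R)) => i _.
by apply: cvgM; exact: cvg_law.
Qed.

Lemma finite_event_prob v : P (finite_event v) = 1%E.
Proof.
rewrite -[LHS]fineK ?fin_num_measure //; last exact: measurable_finite.
have frec u : fine (P (finite_event u)) = 1 - fine (P (split_event u)) +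
    fine (P (split_event u)) * (fine (P (finite_event (rcons u false))) *
      fine (P (finite_event (rcons u true)))).
  apply: (cvg_shift_unique (@cvg_total u) (u' := fun h => 1 - fine (P (split_event u)) +
    fine (P (split_event u)) * (fine (P (total_event h (rcons u false))) *
      fine (P (total_event h (rcons u true)))))); last first.
    move=> h; rewrite (total_rec model).
    rewrite -[P (split_event u)]fineK ?fin_num_measure //; last exact: (measurable_split model).
    rewrite -(fineK (fin_num_measure P _ (measurable_total model h (rcons u false)))).
    by rewrite -(fineK (fin_num_measure P _ (measurable_total model h (rcons u true)))).
  apply: cvgD; first exact: cvg_cst.
  apply: cvgM; first exact: cvg_cst.
  by apply: cvgM; exact: cvg_total.
have off u : ~~ spine u -> fine (P (finite_event u)) = 1.
  move=> us; have := frec u; rewrite (split_prob model) (negbTE us) /=.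
  rewrite (finite_event_spine (v := rcons u false) (v' := u)); last first.
    by rewrite spine_rcons (negbTE us).
  rewrite (finite_event_spine (v := rcons u true) (v' := u)); last first.
    by rewrite spine_rcons (negbTE us).
  set t := fine _ => e.
  (* Off the backbone t = 1/2 + t^2/2, and criticality makes 1 a double root. *)
  have /eqP : (t - 1) ^+ 2 = 0 by rewrite expr2; lra.
  by rewrite expf_eq0 /= subr_eq0 => /eqP.
congr (_%:E); have [vs|] := boolP (spine v); last exact: off.
have := frec v; rewrite (split_prob model) vs.
rewrite (finite_event_spine (v := rcons v false) (v' := v)); last first.
  by rewrite spine_rcons vs.
rewrite (off (rcons v true)) ?spine_rcons ?andbF //= mulr1.
set t := fine _ => e.
(* On the backbone the equation is linear, t = 1 - r + r t with r = [survival 1]; its only root is 1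
   because r < 1. *)
have s1 := survival_lt1 R n_gt0.
have /eqP : (1 - survival 1) * (t - 1) = 0 by lra.
by rewrite mulf_eq0 !subr_eq0 (gt_eqF s1) /= => /eqP.
Qed.

Lemma size_law_sum v : (\sum_(0 <= k <oo) (size_law v k)%:E)%E = 1%E :> \bar R.
Proof.
under eq_eseriesr do rewrite -size_event_prob.
rewrite -(finite_event_prob v) (_ : finite_event v = \bigcup_k size_event v k).
  rewrite measure_semi_bigcup //.
  - by move=> k; exact: measurable_size.
  - apply/trivIsetP => k k' _ _ /eqP kk'; apply/seteqP; split => w //=.
    move=> [[h _ [s sk Es]] [h' _ [s' sk' Es']]]; apply: kk'.
    by rewrite -sk -sk' (act_inj Es Es').
  - by apply: bigcupT_measurable => k; exact: measurable_size.
apply/seteqP; split => w.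
  by move=> [h _ [s _ Es]]; exists (size s) => //; exists h => //; exists s.
by move=> [k _ [h _ [s _ Es]]]; exists h => //; exists s.
Qed.

Lemma size_law_ge0 v k : 0 <= size_law v k.
Proof. by rewrite /size_law fine_ge0. Qed.

End SizeLawLimit.

(** * Uniqueness in the recursions *)

Section Series.
Variable R : realType.
Implicit Types u v w a : nat -> R.

Lemma nneseries_shift1 (f : nat -> \bar R) : (forall k, (1 <= k)%N -> (0 <= f k)%E) ->
  (\sum_(1 <= k <oo) f k = \sum_(0 <= k <oo) f k.+1)%E.
Proof.
move=> f0; have cf : cvgn (fun N => \sum_(1 <= k < N) f k)%E.
  by apply: is_cvg_nneseries => k k1 _; exact: f0.
have := cf; rewrite -(cvg_shiftS (fun N => \sum_(1 <= k < N) f k)%E) => h.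
apply/esym; apply: cvg_lim => //.
by move: h; under eq_fun do rewrite big_add1 /=.
Qed.

(** The nonnegative differences v_k - u_k sum to 0. *)
Lemma nneseries_eq_of_le u v : (forall k, 0 <= u k) -> (forall k, u k <= v k) ->
  (\sum_(0 <= k <oo) (u k)%:E = 1)%E -> (\sum_(0 <= k <oo) (v k)%:E = 1)%E -> u =1 v.
Proof.
move=> u0 uv su sv k; pose dlt j := v j - u j.
have d0 j : 0 <= dlt j by rewrite subr_ge0.
have sd : (\sum_(0 <= j <oo) (dlt j)%:E = 0)%E.
  have : (\sum_(0 <= j <oo) ((u j)%:E + (dlt j)%:E) = 1)%E.
    by rewrite -sv; apply: eq_eseriesr => j _; rewrite -EFinD /dlt addrC subrK.
  rewrite nneseriesD; last 2 first.
  - by move=> j _; rewrite lee_fin.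
  - by move=> j _; rewrite lee_fin.
  rewrite su => /(congr1 (fun z => z - 1)%E).
  by rewrite addeAC !subee ?add0e.
have : ((dlt k)%:E <= 0)%E.
  rewrite -sd; apply: le_trans (nneseries_lim_ge k.+1 _); last first.
    by move=> j _ _; rewrite lee_fin.
  rewrite big_nat_recr //= leeDr // sume_ge0 // => j _.
  by rewrite lee_fin.
by rewrite lee_fin subr_le0 => vu; apply/eqP; rewrite eq_le uv.
Qed.

(* In both recursions u_0 determines u and every term is nondecreasing in u_0,
   so that the normalization of the sum leaves only one solution. *)
Lemma quadratic_recursion_unique a u v : (forall k, 0 <= a k) ->
  (forall k, 0 <= u k) -> (forall k, 0 <= v k) ->
  (forall k, u k.+1 = a k * \sum_(i < k.+1) u i * u (k - i)%N) ->
  (forall k, v k.+1 = a k * \sum_(i < k.+1) v i * v (k - i)%N) ->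
  (\sum_(0 <= k <oo) (u k)%:E = 1)%E -> (\sum_(0 <= k <oo) (v k)%:E = 1)%E -> u =1 v.
Proof.
move=> a0; wlog uv0 : u v / u 0%N <= v 0%N.
  move=> H u0 v0 ur vr su sv; case/orP: (le_total (u 0%N) (v 0%N)) => h; first exact: H.
  by move=> k; apply/esym; exact: H.
move=> u0 v0 ur vr su sv; apply: nneseries_eq_of_le => //.
elim/ltn_ind => -[|k] IH //; rewrite ur vr ler_wpM2l //.
by apply: ler_sum => i _; apply: ler_pM => //; apply: IH; [|lia].
Qed.

Lemma linear_recursion_unique a w u v : (forall k, 0 <= a k) -> (forall k, 0 <= w k) ->
  (forall k, 0 <= u k) -> (forall k, 0 <= v k) ->
  (forall k, u k.+1 = a k * \sum_(i < k.+1) u i * w (k - i)%N) ->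
  (forall k, v k.+1 = a k * \sum_(i < k.+1) v i * w (k - i)%N) ->
  (\sum_(0 <= k <oo) (u k)%:E = 1)%E -> (\sum_(0 <= k <oo) (v k)%:E = 1)%E -> u =1 v.
Proof.
move=> a0 w0; wlog uv0 : u v / u 0%N <= v 0%N.
  move=> H u0 v0 ur vr su sv; case/orP: (le_total (u 0%N) (v 0%N)) => h; first exact: H.
  by move=> k; apply/esym; exact: H.
move=> u0 v0 ur vr su sv; apply: nneseries_eq_of_le => //.
elim/ltn_ind => -[|k] IH //; rewrite ur vr ler_wpM2l //.
by apply: ler_sum => i _; apply: ler_pM => //; apply: IH.
Qed.

(** Adding the sum with reversed index gives the weight (i + 1) + (k - i + 1) = k + 2. *)
Lemma sum_weighted_convolution (e : nat -> R) k :
  2 * \sum_(i < k.+1) (i.+1%:R * e i) * e (k - i)%N =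
  k.+2%:R * \sum_(i < k.+1) e i * e (k - i)%N.
Proof.
rewrite mulr_natl mulr2n {2}(reindex_inj rev_ord_inj) /= -big_split /= mulr_sumr.
apply: eq_bigr => i _; rewrite subSS subKn; last by rewrite -ltnS.
have -> : k.+2%:R = i.+1%:R + (k - i).+1%:R :> R.
  by rewrite -natrD addSn addnS subnKC // -ltnS.
ring.
Qed.

Lemma size_biased_law_unique (n : nat) (p q c : nat -> R) :
  (forall k, 0 <= p k) -> (forall k, 0 <= q k) ->
  (forall k, p k.+1 = 2^-1 * (2 / (2 + k.+1%:R / n%:R)) * \sum_(i < k.+1) p i * p (k - i)%N) ->
  (forall k, q k.+1 = 2 / (2 + k.+1%:R / n%:R) * \sum_(i < k.+1) q i * p (k - i)%N) ->
  (\sum_(0 <= k <oo) (p k)%:E = 1)%E -> (\sum_(0 <= k <oo) (q k)%:E = 1)%E ->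
  solves_E n c -> forall k, q k = k.+1%:R * c k.+1.
Proof.
move=> p0 q0 pr qr sp sq [c0 mom1 cE].
pose e k := c k.+1.
have e0 k : 0 <= e k by exact: c0.
have mom1' : (\sum_(0 <= k <oo) (k.+1%:R * e k)%:E = 1)%E.
  rewrite -mom1 /moment nneseries_shift1; last first.
    by move=> k k1; rewrite lee_fin mulr_ge0 ?exprn_ge0 ?c0.
  by apply: eq_eseriesr => k _; rewrite expr1.
have mom0 : moment 0 c = (\sum_(0 <= k <oo) (e k)%:E)%E.
  rewrite /moment nneseries_shift1; last first.
    by move=> k k1; rewrite lee_fin mulr_ge0 ?exprn_ge0 ?c0.
  by apply: eq_eseriesr => k _; rewrite expr0 mul1r.
have mom0_ge0 : (0 <= moment 0 c)%E.
  by rewrite mom0; apply: nneseries_ge0 => k _ _; rewrite lee_fin.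
have mom0_fin : moment 0 c \is a fin_num.
  rewrite ge0_fin_numE //; apply: le_lt_trans (ltry 1); rewrite mom0 -mom1'.
  apply: lee_nneseries => k _; rewrite lee_fin // -[leLHS]mul1r ler_wpM2r //.
  by rewrite ler1n.
set m := fine (moment 0 c) in cE.
have mE : moment 0 c = m%:E by rewrite /m fineK.
have m_gt0 : 0 < m.
  (* If m_0 vanished, so would every c_k with k >= 1, against m_1 = 1. *)
  rewrite lt_neqAle -lee_fin -mE mom0_ge0 andbT; apply/eqP => m0.
  have : (1 <= 0 :> \bar R)%E; last by rewrite lee_fin ler10.
  rewrite -[leLHS]mom1' le_eqVlt; apply/orP; left; apply/eqP.
  apply: eseries0 => k _ _.
  have : ((e k)%:E <= 0)%E.
    rewrite [leRHS](_ : _ = moment 0 c); last by rewrite mE -m0.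
    rewrite mom0; apply: le_trans (nneseries_lim_ge k.+1 _); last first.
      by move=> j _ _; rewrite lee_fin.
    by rewrite big_nat_recr //= leeDr // sume_ge0 // => j _; rewrite lee_fin.
  rewrite lee_fin => ek; suff -> : e k = 0 by rewrite mulr0.
  by apply/eqP; rewrite eq_le ek e0.
pose a k : R := 2 / (2 + k.+1%:R / n%:R).
have den k : 0 < 2 + k.+1%:R / n%:R :> R by rewrite ltr_wpDr // divr_ge0.
have a0 k : 0 <= a k by rewrite /a divr_ge0 // ltW.
(* (E_n) at index k + 2, where [2^-1 * a k] is 1/(2 + (k+1)/n). *)
have er k : e k.+1 = m^-1 * (2^-1 * a k) * \sum_(i < k.+1) e i * e (k - i)%N.
  have := cE k.+2 isT; rewrite big_add1 /= big_mkord.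
  have -> : \sum_(i < k.+1) c i.+1 * c (k.+2 - i.+1)%N = \sum_(i < k.+1) e i * e (k - i)%N.
    by apply: eq_bigr => i _; rewrite /e subSS subSn // -ltnS.
  have -> : k.+2%:R - 1 = k.+1%:R :> R by rewrite -natr1 addrK.
  rewrite -[c k.+2]/(e k.+1) => h; have D0 := den k.
  move: h; rewrite /a; set D := 2 + _ in D0 *; set S := \sum_(_ < _) _ => h.
  apply: (@mulfI _ D); first by rewrite gt_eqF.
  by rewrite h; field; rewrite !gt_eqF.
have pE : p =1 (fun k => m^-1 * e k).
  apply: (quadratic_recursion_unique (a := fun k => 2^-1 * a k)) => //.
  - by move=> k; rewrite mulr_ge0.
  - by move=> k; rewrite mulr_ge0 // invr_ge0 ltW.
  - move=> k; have -> : \sum_(i < k.+1) m^-1 * e i * (m^-1 * e (k - i)%N) =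
        m^-1 * m^-1 * \sum_(i < k.+1) e i * e (k - i)%N.
      by rewrite mulr_sumr; apply: eq_bigr => i _; ring.
    by rewrite er; ring.
  - under eq_eseriesr do rewrite EFinM.
    rewrite nneseriesZl; last by move=> k _; rewrite lee_fin.
    by rewrite -mom0 mE -EFinM mulVf // gt_eqF.
apply: (linear_recursion_unique (a := a) (w := p)) => //.
- by move=> k; rewrite mulr_ge0 // c0.
- move=> k; rewrite -[c k.+2]/(e k.+1) er.
  have -> : \sum_(i < k.+1) i.+1%:R * c i.+1 * p (k - i)%N =
      m^-1 * \sum_(i < k.+1) (i.+1%:R * e i) * e (k - i)%N.
    by rewrite mulr_sumr; apply: eq_bigr => i _; rewrite pE /e; ring.
  (* The factor 2 of the symmetrization absorbs the 2^-1 of the recursion of e, which is absent from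
     that of q. *)
  have := sum_weighted_convolution e k.
  set W := \sum_(_ < _) (_ * _ * _); set S := \sum_(_ < _) _ => h.
  have -> : W = 2^-1 * (k.+2%:R * S) by rewrite -h mulKf // pnatr_eq0.
  by ring.
Qed.

End Series.

(** * Almost sure events *)

Section NullSets.
Variables (R : realType) (d : measure_display) (Omega : measurableType d).
Variable P : probability Omega R.

Lemma probability_bigcap1 (I : countType) (D : set I) (F : I -> set Omega) :
  (forall i, D i -> measurable (F i)) -> (forall i, D i -> P (F i) = 1%E) ->
  P (\bigcap_(i in D) F i) = 1%E.
Proof.
move=> mF F1; have mG : measurable (\bigcap_(i in D) F i).
  exact: (sigma_bigcap (@sigma_algebra_measurable_set _ Omega)).
have N : P.-negligible (~` \bigcap_(i in D) F i).
  have -> : ~` (\bigcap_(i in D) F i) = \bigcup_m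
      (if @choice.unpickle I m is Some i then if `[< D i >] then ~` F i else set0 else set0).
    rewrite setC_bigcap; apply/seteqP; split => [w [i Di Fi]|w [m _]].
      by exists (choice.pickle i) => //; rewrite choice.pickleK asboolT.
    by case: choice.unpickle => // i; case: asboolP => // Di Fi; exists i.
  apply: negligible_bigcup => m; case: choice.unpickle => [i|]; last exact: negligible_set0.
  case: asboolP => Di; last exact: negligible_set0.
  have F0 : P (~` F i) = 0%E by rewrite probability_setC ?F1 ?subee //; exact: mF.
  by exists (~` F i); split=> //; exact: measurableC (mF _ Di).
have : P (~` \bigcap_(i in D) F i) = 0%E by apply: measure_negligible => //; exact: measurableC.
rewrite probability_setC // -[X in (1 - X)%E]fineK ?fin_num_measure //.
rewrite -EFinB => -[/eqP]; rewrite subr_eq0 => /eqP e.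
by rewrite -[LHS]fineK ?fin_num_measure // -e.
Qed.

Lemma probability_eq_on (A B G : set Omega) : measurable A -> measurable B -> measurable G ->
  P G = 1%E -> A `&` G = B `&` G -> P A = P B.
Proof.
move=> mA mB mG G1 AB.
suff PI C : measurable C -> P C = P (C `&` G) by rewrite (PI _ mA) (PI _ mB) AB.
move=> mC; have N0 : P (C `&` ~` G) = 0%E.
  apply/eqP; rewrite eq_le measure_ge0 andbT.
  rewrite -(_ : P (~` G) = 0%E); last by rewrite probability_setC // G1 subee.
  apply: le_measure; rewrite ?inE //; first by apply: measurableI => //; exact: measurableC.
  exact: measurableC.
have -> : P C = P ((C `&` G) `|` (C `&` ~` G)) by rewrite -setIUr setUv setIT.
have -> : P ((C `&` G) `|` (C `&` ~` G)) = (P (C `&` G) + P (C `&` ~` G))%E.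
  apply: measureU; [exact: measurableI|by apply: measurableI => //; exact: measurableC|].
  by rewrite setIACA setICr setI0.
by rewrite N0 adde0.
Qed.

End NullSets.

(** * From internal nodes to leaves *)

Section Leaves.
Variables (R : realType) (d : measure_display) (Omega : measurableType d).
Variables (P : probability Omega R) (n : nat).
Variables (offspring : nat -> word -> {RV P >-> nat}) (kappa : word -> {RV P >-> R}).
Variable ppp : word -> Omega -> set R.
Hypothesis n_gt0 : (1 <= n)%N.
Hypothesis model : pruning_model n offspring kappa ppp.

Local Notation hit_event := (hit_event kappa ppp).
Local Notation hits := (hits kappa ppp).
Local Notation spine_split := (spine_split offspring kappa ppp).
Local Notation size_event := (size_event offspring kappa ppp).
Local Notation finite_event := (finite_event offspring kappa ppp).

Let branches_at w := branches (fun i u => offspring i u w).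

(* [truncate] looks at all infinite branches: it departs from [spine_split] on
   the null event that some G(i) is infinite, which still has to be handled for
   the event of the theorem to be measurable. *)
Definition truncation_split (w : Omega) (v : word) : bool :=
  branches_at w v &&
  ~~ `[< on_infinite_branch (split_tree (branches_at w)) v /\ hit_event v v w >].

Lemma measurable_hit x v : prefix v x -> measurable (hit_event x v).
Proof. by move=> vx; apply: (measurable_info model (K := setT)); exact: info_hit. Qed.

Lemma measurable_branch u : measurable (branch_event offspring u).
Proof. by apply: (measurable_info model (K := setT)); exact: info_branch. Qed.

Lemma measurable_truncation_split v : measurable [set w | truncation_split w v].
Proof.
have sm := @sigma_algebra_measurable_set _ Omega.
have mT u : measurable [set w | split_tree (branches_at w) u].
  have -> : [set w | split_tree (branches_at w) u] =
      \bigcap_(v in [set v | strict_prefix v u]) branch_event offspring v.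
    by apply/seteqP; split => w /= h v'; exact: h.
  by apply: (sigma_bigcap sm) => v' _; exact: measurable_branch.
have mI : measurable [set w | on_infinite_branch (split_tree (branches_at w)) v].
  have -> : [set w | on_infinite_branch (split_tree (branches_at w)) v] =
      \bigcap_m \bigcup_(u in [set u : word | size u = m])
        [set w | split_tree (branches_at w) (v ++ u)].
    apply/seteqP; split => w.
      move=> /on_infinite_branchP-/(_ (@split_tree_prefix _)) h m _.
      by have [u su Tu] := h m; exists u.
    move=> h; apply/on_infinite_branchP; first exact: split_tree_prefix.
    by move=> m; have [u su Tu] := h m Logic.I; exists u.
  apply: (sigma_bigcap sm) => m _; apply: (sigma_bigcup sm) => u _; exact: mT.
have -> : [set w | truncation_split w v] = branch_event offspring v `&`
    ~` ([set w | on_infinite_branch (split_tree (branches_at w)) v] `&` hit_event v v).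
  apply/seteqP; split => w; first by move=> /andP[Bv /asboolPn N].
  by move=> [Bv N]; apply/andP; split=> //; exact/asboolPn.
apply: measurableI; first exact: measurable_branch.
apply: measurableC; apply: measurableI => //.
by apply: measurable_hit; exact: prefix_refl.
Qed.

(** The constant branch [false] makes every backbone vertex lie on an infinite branch; off the
    backbone, success of [act] at some height excludes one. *)
Lemma truncation_split_ae w : (forall v, ~~ spine v -> finite_event v w) ->
  truncation_split w = spine_split w.
Proof.
move=> fin; apply/funext => v; rewrite /truncation_split /spine_split.
congr (_ && ~~ _).
have [vs|vN] /= := boolP (spine v).
  rewrite /hits; apply: asbool_equiv_eq; split=> [[]//|h]; split=> //.
  have mkE m : mkseq (fun=> false) m = nseq m false.
    apply: (@eq_from_nth _ false); rewrite size_mkseq ?size_nseq // => i im.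
    by rewrite nth_mkseq // nth_nseq im.
  exists (fun=> false); split=> [m u um|]; last by rewrite mkE; exact/eqP.
  rewrite /branches_at /branches (spine_prefix (v := mkseq (fun=> false) m)) //.
    by case/andP: um.
  by rewrite mkE spine_nseq.
apply/asboolPn => -[inf _].
have [h _ [s _ Es]] := fin v vN.
have := Es; rewrite /act_event /=.
move: inf => /(on_infinite_branchP _ (@split_tree_prefix (branches_at w)))/(_ h.+1)[u su Tu].
rewrite (@act_none_of _ _ _ _ u) ?su //.
move=> i ih; rewrite /spine_split; apply/andP; split.
  apply: Tu; rewrite strict_prefixE prefix_catr // eqxx prefix_take /= !size_cat size_takel ?su; lia.
have -> : spine (v ++ take i u) = false.
  by apply/negbTE; apply: contra vN; apply: spine_prefix; exact: prefix_prefix.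
by [].
Qed.

(** The predecessor appears because a binary tree has one more leaf than internal nodes. The event
    is a countable union over heights and lists for [truncation_split], which agrees with
    [spine_split] almost surely. *)
Lemma leaves_event_prob k : (1 <= k)%N ->
  P [set w | #|` leaves (prune (fun v => kappa v w) (fun x => ppp x w)
       (size_biased (fun i u => offspring i u w)))| = k] = (size_law offspring kappa ppp [::] k.-1)%:E.
Proof.
move=> k1; rewrite -(size_event_prob model).
have sm := @sigma_algebra_measurable_set _ Omega.
have -> : [set w | #|` leaves (prune (fun v => kappa v w) (fun x => ppp x w)
       (size_biased (fun i u => offspring i u w)))| = k] =
    \bigcup_h \bigcup_(s in [set s : seq word | (size s).+1 = k])
      act_event kappa ppp truncation_split h [::] s.
  have pruneP w := @card_leaves_prune R (fun v => kappa v w) (fun x => ppp x w)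
    (size_biased (fun i u => offspring i u w)) (truncation_split w) k
    (fun v => ltW (kappa_gt0 model v w))
    (fun x a => ppp_locally_finite (ppp_rate model x) w a)
    (etrans (congr1 _ (size_biasedE _)) (truncateE _ _ _)) k1.
  apply/seteqP; split => w.
    by move=> /pruneP[h [s [Es sk]]]; exists h => //; exists s.
  by move=> [h _ [s /= sk Es]]; apply/pruneP; exists h, s.
apply: (@probability_eq_on _ _ _ P _ _
  (\bigcap_(v in [set v | ~~ spine v]) finite_event v)).
- apply: (sigma_bigcup sm) => h _; apply: (sigma_bigcup sm) => s _.
  apply: sigma_act => //; first by move=> u _; exact: measurable_truncation_split.
  by move=> u x _; exact: measurable_hit.
- exact: (measurable_size model).
- by apply: (sigma_bigcap sm) => v _; exact: (measurable_finite model).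
- apply: probability_bigcap1 => v _; first exact: (measurable_finite model).
  exact: (finite_event_prob n_gt0 model).
- apply/seteqP; split => w [Ew Gw]; split=> //.
    move: Ew => [h _ [s /= sk]]; rewrite /act_event /= truncation_split_ae // => Es.
    by exists h => //; exists s => //=; rewrite -sk.
  move: Ew => [h _ [s /= sk Es]]; exists h => //; exists s; first by rewrite /= sk prednK.
  by rewrite /act_event /= truncation_split_ae.
Qed.

End Leaves.

Theorem proposition17 (R : realType) (d : measure_display)
    (Omega : measurableType d) (P : probability Omega R) (n : nat)
    (offspring : nat -> word -> {RV P >-> nat})
    (kappa : word -> {RV P >-> R}) (ppp : word -> Omega -> set R)
    (c : nat -> R) :
  (1 <= n)%N ->
  pruning_model n offspring kappa ppp ->
  solves_E n c ->
  forall k : nat, (1 <= k)%N ->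
    let Ghat w := size_biased (fun i u => offspring i u w) in
    let Ghat_n w := prune (fun v => kappa v w) (fun x => ppp x w) (Ghat w) in
    P [set w | #|` leaves (Ghat_n w)| = k] = (k%:R * c k)%:E.
Proof.
move=> n1 model cE k k1 /=; rewrite (leaves_event_prob n1 model k1).
rewrite -[X in (X%:R * c X)%:E](prednK k1); congr (_%:E).
(* [[:: true]], the root of G(1), stands for all vertices off the backbone and [[::]] for those on
   it; by [size_law_spine] the law depends on nothing else. *)
apply: (@size_biased_law_unique _ n (size_law offspring kappa ppp [:: true])) => //.
- by move=> j; exact: size_law_ge0.
- by move=> j; exact: size_law_ge0.
- move=> j; rewrite (size_law_rec model) /=; congr (_ * _); apply: eq_bigr => i _.
  by rewrite !(size_law_spine model (v' := [:: true])).
- move=> j; rewrite (size_law_rec model) /= mul1r; congr (_ * _); apply: eq_bigr => i _.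
  rewrite (size_law_spine model (v := rcons [::] false) (v' := [::])) //.
- exact: (size_law_sum n1 model).
- exact: (size_law_sum n1 model).
Qed.
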